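(* The formal system $\mathrm{RST}_{ext}$ is an sf-theory and a conservative extension of RST. Moreover, for all collections of distinct variables $x,y,z,u,v,w$ the following formulas are provable in RST, and more generally in every sf-theory $[M;\mathcal{L}]$: (a) Existence of the empty set: $\exists u\,\forall y\,\bigl(y\in u\leftrightarrow (y\in x\wedge\neg\, y\in x)\bigr)$ and $\exists u\,\forall y\,\neg\, y\in u$. (b) Existence of unions: $\exists u\,\forall z\,\bigl(z\in u\leftrightarrow\exists y\,(z\in y\wedge y\in x)\bigr)$. (c) Existence of pair sets: $\exists u\,\forall z\,\bigl(z\in u\leftrightarrow (z=x\vee z=y)\bigr)$. (d) Existence of power sets: $\exists z\,\forall v\,\bigl(v\in z\leftrightarrow\forall w\,(w\in v\to w\in x)\bigr)$. (e) Existence of an inductive set: $\exists x\,\Bigl(\exists y\,\bigl(y\in x\wedge\forall z\,\neg\, z\in y\bigr)\wedge\forall y\,\bigl(y\in x\to\exists z\,(z\in x\wedge\forall v\,(v\in z\leftrightarrow (v\in y\vee v=y)))\bigr)\Bigr)$.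
   Context: Formal systems. A formal mathematical system $[M;\mathcal{L}]$ with $M=[A;P;B]$ is a first-order theory with equality in a classical Hilbert-style calculus: the variables are $X=\{\mathbf{x}_1,\mathbf{x}_2,\ldots\}$; $A$ is the set of constant and function symbols and $P$ the set of predicate symbols, each of fixed arity; $\mathcal{L}$ is the set of all terms built from $X$ and $A$; $B$ is the set of (non-logical) basis axioms, which may contain free variables. Formulas are built from equations between terms and atomic formulas with predicates in $P$ using $\neg,\to,\wedge,\vee,\leftrightarrow,\forall,\exists$. $\Pi(M;\mathcal{L})$ is the set of formulas provable from the propositional, quantifier and equality axioms and $B$ by modus ponens, collision-free substitution of terms for free variables, and generalization ($F\vdash\forall x F$). $\mathrm{var}(F)$ is the set of all variables occurring (free or bound) in $F$. $[M';\mathcal{L}']$ with $M'=[A';P';B']$ is an extension of $[M;\mathcal{L}]$ if $A\subseteq A'$, $P\subseteq P'$, $\mathcal{L}\subseteq\mathcal{L}'$ and $\Pi(M;\mathcal{L})\subseteq\Pi(M';\mathcal{L}')$; it is a conservative extension if in addition every formula of $[M;\mathcal{L}]$ provable in $[M';\mathcal{L}']$ is provable in $[M;\mathcal{L}]$. RST. RST has no constant or function symbols, the single binary predicate $\in$ (besides equality), terms only variables, and the following axioms for all choices of distinct variables $t,u,v,w,x,y,z$: A1 $\forall y\,(y\in u\leftrightarrow y\in v)\to u=v$. A2 $\exists u\,\forall y\,(y\in u\leftrightarrow (y\in x\wedge F))$ for all RST-formulas $F$ with $u,x\notin\mathrm{var}(F)$. A3 $\exists y\,y\in u\to\exists y\,(y\in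 u\wedge\neg\exists z\,(z\in u\wedge z\in y))$. A4 $\exists u\,(x\in u\wedge y\in u)$. A5 $\exists u\,[\,x\in u\ \wedge\ \forall y(y\in u\to\forall z(z\in y\to z\in u))\ \wedge\ \forall y(y\in u\to\exists z(z\in u\wedge\forall v(v\in z\leftrightarrow\forall w(w\in v\to w\in y))))\ \wedge\ \forall y(y\in u\to\forall z(z\in u\to\exists v(v\in u\wedge (y\in v\wedge z\in v)\wedge\forall w(w\in v\to\forall t(t\in w\to t\in v)))))\,]$. A6 $\forall x(x\in u\to\exists w\,w\in x)\to\bigl[\forall x\forall y(x\in u\to(y\in u\to(\exists w(w\in x\wedge w\in y)\to x=y)))\to\exists y\forall x(x\in u\to\exists v((v\in x\wedge v\in y)\wedge\forall w((w\in x\wedge w\in y)\to v=w)))\bigr]$. sf-theory. An extension $[M;\mathcal{L}]$ of RST (including RST itself) is a subset-friendly theory (sf-theory) if the formulas $\exists u\,\forall y\,(y\in u\leftrightarrow (y\in x\wedge F))$ are provable in $[M;\mathcal{L}]$ for all distinct variables $x,y,u$ and all formulas $F$ of $[M;\mathcal{L}]$ with $u,x\notin\mathrm{var}(F)$. $\mathrm{RST}_{ext}$. It results from RST by adding the constant symbol $\emptyset$, the binary predicate $\subseteq$, the unary function symbols $\cup,\sigma,\mathcal{P}$, the binary function symbol $\sigma_2$, and the following axioms for all choices of distinct variables (its axioms are A1–A6, with A2 only for RST-formulas $F$, together with E1–E6; its terms are all terms built from variables and these symbols): E1 $u=\emptyset\leftrightarrow\forall y\,\neg\,y\in u$. E2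 $u\subseteq v\leftrightarrow\forall y\,(y\in u\to y\in v)$. E3 $u=\cup(x)\leftrightarrow\forall z\,(z\in u\leftrightarrow\exists y\,(z\in y\wedge y\in x))$. E4 $u=\sigma(x)\leftrightarrow\forall y\,(y\in u\leftrightarrow y=x)$. E5 $u=\sigma_2(x\,y)\leftrightarrow\forall z\,(z\in u\leftrightarrow (z=x\vee z=y))$. E6 $z=\mathcal{P}(x)\leftrightarrow\forall v\,(v\in z\leftrightarrow\forall w\,(w\in v\to w\in x))$. *)

(* Defs.v *)
From mathcomp Require Import all_boot.
From Stdlib Require List.

Set Implicit Arguments.
Unset Strict Implicit.
Unset Printing Implicit Defensive.

(** * First-order systems with equality, in a Hilbert-style calculus *)

(* The stock of symbols from which all systems under consideration draw their
   constant, function and predicate symbols. Systems sharing a vocabulary can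
   be compared by plain inclusion; constants are function symbols of arity 0. *)
Record vocabulary := Vocabulary {
  fsym : Type;
  psym : Type;
  far : fsym -> nat;
  par : psym -> nat }.

(* The variable [n] stands for the (n+1)-st variable of X. Raw terms and
   formulas ignore arities and membership of the symbols in A and P; these are
   imposed by [term_of] and [formula_of]. *)
Inductive term (V : vocabulary) : Type :=
| Var (x : nat)
| App (f : fsym V) (ts : seq (term V)).
Arguments Var {V} x.

Inductive formula (V : vocabulary) : Type :=
| Eq (s t : term V)
| Rel (p : psym V) (ts : seq (term V))
| Neg (F : formula V)
| Imp (F G : formula V)
| And (F G : formula V)
| Or (F G : formula V)
| Iff (F G : formula V)
| All (x : nat) (F : formula V)
| Ex (x : nat) (F : formula V).

Declare Scope fol_scope.
Delimit Scope fol_scope with fol.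
Bind Scope fol_scope with formula.

(* Between variables; [Eq] and [Rel] cover the other atomic formulas. *)
Notation "x =' y" := (Eq (Var x) (Var y)) (at level 70) : fol_scope.
Notation "¬' F" := (Neg F) (at level 75, right associativity) : fol_scope.
Notation "F ∧' G" := (And F G) (at level 80, right associativity) : fol_scope.
Notation "F ∨' G" := (Or F G) (at level 85, right associativity) : fol_scope.
Notation "F ↔' G" := (Iff F G) (at level 95, no associativity) : fol_scope.
Notation "F →' G" := (Imp F G) (at level 99, right associativity) : fol_scope.
Notation "∀' x , F" := (All x F)
  (at level 200, x at level 69, right associativity) : fol_scope.
Notation "∃' x , F" := (Ex x F)
  (at level 200, x at level 69, right associativity) : fol_scope.
Local Open Scope fol_scope.

Record language (V : vocabulary) := Language {
  lfun : fsym V -> Prop;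
  lpred : psym V -> Prop }.

Inductive term_of (V : vocabulary) (L : language V) : term V -> Prop :=
| term_of_Var x : term_of L (Var x)
| term_of_App f ts :
    lfun L f -> size ts = far f -> List.Forall (term_of L) ts ->
    term_of L (App f ts).

Fixpoint formula_of (V : vocabulary) (L : language V) (F : formula V) : Prop :=
  match F with
  | Eq s t => term_of L s /\ term_of L t
  | Rel p ts => [/\ lpred L p, size ts = par p & List.Forall (term_of L) ts]
  | Neg G => formula_of L G
  | Imp G H | And G H | Or G H | Iff G H => formula_of L G /\ formula_of L H
  | All _ G | Ex _ G => formula_of L G
  end.

Record system (V : vocabulary) := System {
  lang :> language V;
  basis : formula V -> Prop;
  basis_wf : forall F, basis F -> formula_of lang F }.

Fixpoint tvars (V : vocabulary) (t : term V) : seq nat :=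
  match t with
  | Var x => [:: x]
  | App _ ts => flatten (map (@tvars V) ts)
  end.

(* var(F): the bound variable of a quantifier counts even if it does not occur
   in its scope. *)
Fixpoint vars (V : vocabulary) (F : formula V) : seq nat :=
  match F with
  | Eq s t => tvars s ++ tvars t
  | Rel _ ts => flatten (map (@tvars V) ts)
  | Neg G => vars G
  | Imp G H | And G H | Or G H | Iff G H => vars G ++ vars H
  | All x G | Ex x G => x :: vars G
  end.

Fixpoint free (V : vocabulary) (F : formula V) : seq nat :=
  match F with
  | Eq s t => tvars s ++ tvars t
  | Rel _ ts => flatten (map (@tvars V) ts)
  | Neg G => free G
  | Imp G H | And G H | Or G H | Iff G H => free G ++ free H
  | All x G | Ex x G => [seq y <- free G | y != x]
  end.

Fixpoint tsubst (V : vocabulary) (x : nat) (t s : term V) : term V :=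
  match s with
  | Var y => if y == x then t else s
  | App f ts => App f (map (tsubst x t) ts)
  end.

Fixpoint subst (V : vocabulary) (x : nat) (t : term V) (F : formula V) :
    formula V :=
  match F with
  | Eq r s => Eq (tsubst x t r) (tsubst x t s)
  | Rel p ts => Rel p (map (tsubst x t) ts)
  | Neg G => Neg (subst x t G)
  | Imp G H => Imp (subst x t G) (subst x t H)
  | And G H => And (subst x t G) (subst x t H)
  | Or G H => Or (subst x t G) (subst x t H)
  | Iff G H => Iff (subst x t G) (subst x t H)
  | All y G => if y == x then F else All y (subst x t G)
  | Ex y G => if y == x then F else Ex y (subst x t G)
  end.

(* No free occurrence of [x] lies in the scope of a quantifier binding a
   variable of [t]. *)
Fixpoint collision_free (V : vocabulary) (x : nat) (t : term V)
    (F : formula V) : bool :=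
  match F with
  | Eq _ _ | Rel _ _ => true
  | Neg G => collision_free x t G
  | Imp G H | And G H | Or G H | Iff G H =>
      collision_free x t G && collision_free x t H
  | All y G | Ex y G =>
      (x \notin free F) || ((y \notin tvars t) && collision_free x t G)
  end.

(* Truth value under an assignment [v] to the formulas that are not
   propositional compounds. *)
Fixpoint peval (V : vocabulary) (v : formula V -> bool) (F : formula V) :
    bool :=
  match F with
  | Neg G => ~~ peval v G
  | Imp G H => peval v G ==> peval v H
  | And G H => peval v G && peval v H
  | Or G H => peval v G || peval v H
  | Iff G H => peval v G == peval v H
  | _ => v F
  end.

Definition tautology (V : vocabulary) (F : formula V) : Prop :=
  forall v, peval v F.

Definition eqs_imp (V : vocabulary) (ss ts : seq (term V)) (F : formula V) :
    formula V :=
  foldr (@Imp V) F [seq Eq p.1 p.2 | p <- zip ss ts].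

Inductive logical_axiom (V : vocabulary) (L : language V) :
    formula V -> Prop :=
| Ax_taut F : formula_of L F -> tautology F -> logical_axiom L F
| Ax_all_elim x F : formula_of L F -> logical_axiom L ((∀' x, F) →' F)
| Ax_all_imp x F G :
    formula_of L F -> formula_of L G -> x \notin free F ->
    logical_axiom L ((∀' x, F →' G) →' (F →' ∀' x, G))
| Ax_ex x F :
    formula_of L F -> logical_axiom L ((∃' x, F) ↔' ¬' (∀' x, ¬' F))
| Ax_eq_refl t : term_of L t -> logical_axiom L (Eq t t)
| Ax_eq_eq s1 s2 t1 t2 :
    formula_of L (Eq s1 s2) -> formula_of L (Eq t1 t2) ->
    logical_axiom L (Eq s1 t1 →' (Eq s2 t2 →' (Eq s1 s2 →' Eq t1 t2)))
| Ax_eq_fun f ss ts :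
    term_of L (App f ss) -> term_of L (App f ts) ->
    logical_axiom L (eqs_imp ss ts (Eq (App f ss) (App f ts)))
| Ax_eq_pred p ss ts :
    formula_of L (Rel p ss) -> formula_of L (Rel p ts) ->
    logical_axiom L (eqs_imp ss ts (Rel p ss →' Rel p ts)).

Inductive provable (V : vocabulary) (M : system V) : formula V -> Prop :=
| Pr_logical F : logical_axiom M F -> provable M F
| Pr_basis F : basis M F -> provable M F
| Pr_mp F G : provable M F -> provable M (F →' G) -> provable M G
| Pr_subst x t F :
    provable M F -> term_of M t -> collision_free x t F ->
    provable M (subst x t F)
| Pr_gen x F : provable M F -> provable M (∀' x, F).

Definition extension (V : vocabulary) (M M' : system V) : Prop :=
  [/\ forall f, lfun M f -> lfun M' f,
      forall p, lpred M p -> lpred M' p,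
      forall t, term_of M t -> term_of M' t
    & forall F, provable M F -> provable M' F].

Definition conservative_extension (V : vocabulary) (M M' : system V) : Prop :=
  extension M M' /\
  forall F, formula_of M F -> provable M' F -> provable M F.

(** * Set theory *)

Inductive set_fsym (T : Type) : Type :=
| Sempty | Sunion | Ssingle | Spower | Spair | Sother (f : T).
Arguments Sempty {T}. Arguments Sunion {T}. Arguments Ssingle {T}.
Arguments Spower {T}. Arguments Spair {T}.

Inductive set_psym (T : Type) : Type :=
| Rin | Rsub | Rother (p : T).
Arguments Rin {T}. Arguments Rsub {T}.

(* The symbols of set theory, together with an arbitrary stock [O] of further
   symbols on which extensions of RST may draw. *)
Definition set_vocabulary (O : vocabulary) : vocabulary := {|
  fsym := set_fsym (fsym O);
  psym := set_psym (psym O);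
  far := fun f => match f with
    | Sempty => 0 | Sunion | Ssingle | Spower => 1 | Spair => 2
    | Sother g => far g end;
  par := fun p => match p with
    | Rin | Rsub => 2 | Rother q => par q end |}.

Definition mem_fm (O : vocabulary) (x y : nat) : formula (set_vocabulary O) :=
  @Rel (set_vocabulary O) Rin [:: Var x; Var y].
Arguments mem_fm {O} x y.
Notation "x ∈' y" := (mem_fm x y) (at level 70) : fol_scope.

Definition sub_fm (O : vocabulary) (x y : nat) : formula (set_vocabulary O) :=
  @Rel (set_vocabulary O) Rsub [:: Var x; Var y].
Arguments sub_fm {O} x y.
Notation "x ⊆' y" := (sub_fm x y) (at level 70) : fol_scope.

(* [u = f(xs)], for a set-theoretic function symbol applied to variables. *)
Definition eq_app (O : vocabulary) (u : nat) (f : set_fsym (fsym O))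
    (xs : seq nat) : formula (set_vocabulary O) :=
  @Eq (set_vocabulary O) (Var u)
    (@App (set_vocabulary O) f [seq Var x | x <- xs]).
Arguments eq_app {O} u f xs.

Definition RST_lang (O : vocabulary) : language (set_vocabulary O) :=
  @Language (set_vocabulary O) (fun _ => False) (fun p => p = Rin).

Definition separation (O : vocabulary) (x y u : nat)
    (F : formula (set_vocabulary O)) : formula (set_vocabulary O) :=
  ∃' u, ∀' y, (y ∈' u ↔' (y ∈' x ∧' F)).

Inductive RST_axiom (O : vocabulary) : formula (set_vocabulary O) -> Prop :=
| A1 (y u v : nat) : uniq [:: y; u; v] ->
    RST_axiom ((∀' y, (y ∈' u ↔' y ∈' v)) →' u =' v)
| A2 (x y u : nat) F : uniq [:: x; y; u] -> formula_of (RST_lang O) F ->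
    u \notin vars F -> x \notin vars F ->
    RST_axiom (separation x y u F)
| A3 (u y z : nat) : uniq [:: u; y; z] ->
    RST_axiom ((∃' y, y ∈' u) →'
      ∃' y, (y ∈' u ∧' ¬' (∃' z, (z ∈' u ∧' z ∈' y))))
| A4 (x y u : nat) : uniq [:: x; y; u] ->
    RST_axiom (∃' u, (x ∈' u ∧' y ∈' u))
| A5 (t u v w x y z : nat) : uniq [:: t; u; v; w; x; y; z] ->
    RST_axiom (∃' u,
      (x ∈' u
       ∧' (∀' y, (y ∈' u →' ∀' z, (z ∈' y →' z ∈' u)))
       ∧' (∀' y, (y ∈' u →' ∃' z, (z ∈' u ∧'
             ∀' v, (v ∈' z ↔' ∀' w, (w ∈' v →' w ∈' y)))))
       ∧' (∀' y, (y ∈' u →' ∀' z, (z ∈' u →' ∃' v,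
             (v ∈' u ∧' (y ∈' v ∧' z ∈' v) ∧'
              ∀' w, (w ∈' v →' ∀' t, (t ∈' w →' t ∈' v))))))))
| A6 (u v w x y : nat) : uniq [:: u; v; w; x; y] ->
    RST_axiom ((∀' x, (x ∈' u →' ∃' w, w ∈' x)) →'
      ((∀' x, ∀' y, (x ∈' u →' (y ∈' u →'
           ((∃' w, (w ∈' x ∧' w ∈' y)) →' x =' y)))) →'
       ∃' y, ∀' x, (x ∈' u →' ∃' v, ((v ∈' x ∧' v ∈' y) ∧'
           ∀' w, ((w ∈' x ∧' w ∈' y) →' v =' w))))).

Definition RST_ext_lang (O : vocabulary) : language (set_vocabulary O) :=
  @Language (set_vocabulary O)
    (fun f => match f with Sother _ => False | _ => True end)
    (fun p => match p with Rother _ => False | _ => True end).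

Inductive RST_ext_axiom (O : vocabulary) :
    formula (set_vocabulary O) -> Prop :=
| E0 F : RST_axiom F -> RST_ext_axiom F
| E1 (u y : nat) : uniq [:: u; y] ->
    RST_ext_axiom (eq_app u Sempty [::] ↔' ∀' y, ¬' (y ∈' u))
| E2 (u v y : nat) : uniq [:: u; v; y] ->
    RST_ext_axiom (u ⊆' v ↔' ∀' y, (y ∈' u →' y ∈' v))
| E3 (u x y z : nat) : uniq [:: u; x; y; z] ->
    RST_ext_axiom (eq_app u Sunion [:: x] ↔'
      ∀' z, (z ∈' u ↔' ∃' y, (z ∈' y ∧' y ∈' x)))
| E4 (u x y : nat) : uniq [:: u; x; y] ->
    RST_ext_axiom (eq_app u Ssingle [:: x] ↔'
      ∀' y, (y ∈' u ↔' y =' x))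
| E5 (u x y z : nat) : uniq [:: u; x; y; z] ->
    RST_ext_axiom (eq_app u Spair [:: x; y] ↔'
      ∀' z, (z ∈' u ↔' (z =' x ∨' z =' y)))
| E6 (z x v w : nat) : uniq [:: z; x; v; w] ->
    RST_ext_axiom (eq_app z Spower [:: x] ↔'
      ∀' v, (v ∈' z ↔' ∀' w, (w ∈' v →' w ∈' x))).

Lemma term_of_mono (V : vocabulary) (L L' : language V) :
  (forall f, lfun L f -> lfun L' f) -> forall t, term_of L t -> term_of L' t.
Proof.
move=> LL'; fix IH 2 => t [x|f ts Lf sz Hts]; first exact: term_of_Var.
apply: term_of_App (LL' _ Lf) sz _.
elim: Hts => [|s ss Hs _ IHss]; constructor => //; exact: IH.
Qed.

Lemma formula_of_mono (V : vocabulary) (L L' : language V) :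
  (forall f, lfun L f -> lfun L' f) -> (forall p, lpred L p -> lpred L' p) ->
  forall F, formula_of L F -> formula_of L' F.
Proof.
move=> Lf Lp; have Lt := term_of_mono Lf.
elim=> [s t|p ts|F IH|F IHF G IHG|F IHF G IHG|F IHF G IHG|F IHF G IHG
       |x F IH|x F IH] //=; try by case; auto.
by case=> /Lp Hp sz Hts; split => //; apply: List.Forall_impl Hts.
Qed.

Lemma RST_axiom_wf (O : vocabulary) (F : formula (set_vocabulary O)) :
  RST_axiom F -> formula_of (RST_lang O) F.
Proof. by case=> *; repeat first [constructor | assumption]. Qed.

Lemma RST_ext_axiom_wf (O : vocabulary) (F : formula (set_vocabulary O)) :
  RST_ext_axiom F -> formula_of (RST_ext_lang O) F.
Proof.
case=> [{}F /RST_axiom_wf|*|*|*|*|*|*];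
  first by apply: formula_of_mono => //= _ ->.
all: by repeat first [constructor | assumption].
Qed.

Definition RST (O : vocabulary) : system (set_vocabulary O) :=
  System (@RST_axiom_wf O).

Definition RST_ext (O : vocabulary) : system (set_vocabulary O) :=
  System (@RST_ext_axiom_wf O).

Definition sf_theory (O : vocabulary) (M : system (set_vocabulary O)) : Prop :=
  extension (RST O) M /\
  forall (x y u : nat) F, uniq [:: x; y; u] -> formula_of M F ->
    u \notin vars F -> x \notin vars F -> provable M (separation x y u F).

Definition proves_set_existence (O : vocabulary)
    (M : system (set_vocabulary O)) : Prop :=
  forall x y z u v w : nat, uniq [:: x; y; z; u; v; w] ->
  [/\ provable M (∃' u, ∀' y, (y ∈' u ↔' (y ∈' x ∧' ¬' (y ∈' x))))
      /\ provable M (∃' u, ∀' y, ¬' (y ∈' u)),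
      provable M (∃' u, ∀' z, (z ∈' u ↔' ∃' y, (z ∈' y ∧' y ∈' x))),
      provable M (∃' u, ∀' z, (z ∈' u ↔' (z =' x ∨' z =' y))),
      provable M (∃' z, ∀' v, (v ∈' z ↔' ∀' w, (w ∈' v →' w ∈' x)))
    & provable M (∃' x, ((∃' y, (y ∈' x ∧' ∀' z, ¬' (z ∈' y))) ∧'
        ∀' y, (y ∈' x →' ∃' z, (z ∈' x ∧'
          ∀' v, (v ∈' z ↔' (v ∈' y ∨' v =' y))))))].

(* Main.v *)
Require Import Defs.
From mathcomp Require Import all_boot boolp.

(** The two systems are compared through their models, which a completeness
   theorem makes legitimate: a formula is provable in RST, or in RST_ext, as
   soon as it holds in every structure satisfying the axioms. Since an
   sf-theory extends RST, what RST proves it proves too, so (a)-(e) are needed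
   for RST only.

   - Existence of sets ([proves_set_existence_RST]). In a model of RST, A5 puts
     any element into a transitive universe [u], and separation cuts the wanted
     set out of it: the union of [x] is a subset of a universe containing [x],
     pairs come from A4, power sets are given by A5 itself, and the universe is
     an inductive set because it contains with [y] some transitive [v] having
     [y] as an element, hence contains the subset [y ∪ {y}] of [v].

   - Conservativity ([conservative_RST_ext]). These existence results and
     extensionality let every model of RST be expanded to a model of RST_ext
     without changing the truth of RST-formulas. By soundness an RST-formula
     provable in RST_ext holds in all models of RST.

   - Separation in RST_ext ([sf_theory_RST_ext]). The axioms E1-E6 define the
     new symbols by RST-formulas. By induction, every formula of RST_ext holds
     under the same assignments as some RST-formula ([definable_formula]), to
     which A2 applies. That formula may contain the variables excluded by A2,
     but in a model the variables of the instance can be chosen anew.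

   Completeness ([completeness]) is proved by Henkin's method. Theorems are
   closed under generalization, so at each stage finitely many assumptions,
   kept as one conjunction, suffice, and fresh variables can serve as witnesses
   in place of new constants. The elements of the model are variables modulo
   the equations of the resulting maximal consistent set. To instantiate quantifiers by variables without collision,
   the formula under consideration is first renamed so that its bound variables
   are even, and all witnesses are odd. This needs axioms stable under injective
   renamings of the variables, which holds as they are stated for all choices of
   distinct variables, and formulas that can be enumerated. *)

Set Implicit Arguments.
Unset Strict Implicit.
Unset Printing Implicit Defensive.

Local Open Scope fol_scope.


(** * Terms and variables *)

Lemma term_nested_ind (V : vocabulary) (P : term V -> Prop) :
  (forall x, P (Var x)) ->
  (forall f ts, List.Forall P ts -> P (App f ts)) ->
  forall t, P t.
Proof.
move=> PV PA; fix IH 1 => -[x|f ts]; first exact: PV.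
by apply: PA; elim: ts => [|t ts IHts]; constructor.
Qed.

Lemma eq_map_Forall (T U : Type) (g h : T -> U) (s : seq T) :
  List.Forall (fun x => g x = h x) s -> map g s = map h s.
Proof. by elim=> //= x {}s -> _ ->. Qed.

Lemma Forall_mp (T : Type) (P Q : T -> Prop) (s : seq T) :
  List.Forall (fun x => P x -> Q x) s -> List.Forall P s -> List.Forall Q s.
Proof.
by elim=> // x {}s PQ _ IH /List.Forall_cons_iff[/PQ Qx /IH]; constructor.
Qed.

Lemma Forall_map (T U : Type) (P : U -> Prop) (g : T -> U) (s : seq T) :
  List.Forall (fun x => P (g x)) s -> List.Forall P (map g s).
Proof. by elim=> // x {}s Px _ IH; constructor. Qed.

(** The form in which the hypotheses of [term_nested_ind] are met when the
   property concerns the variables of a term. *)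
Lemma Forall_tvars (V : vocabulary) (R : nat -> Prop) (P : term V -> Prop)
    (ts : seq (term V)) :
  List.Forall (fun t => (forall x, x \in tvars t -> R x) -> P t) ts ->
  (forall x, x \in flatten (map (@tvars V) ts) -> R x) -> List.Forall P ts.
Proof.
elim=> //= t {}ts Pt _ IH Rts; constructor.
  by apply: Pt => x xt; apply: Rts; rewrite mem_cat xt.
by apply: IH => x xts; apply: Rts; rewrite mem_cat xts orbT.
Qed.

Lemma term_of_AppE (V : vocabulary) (L : language V) f ts :
  term_of L (App f ts) ->
  [/\ lfun L f, size ts = far f & List.Forall (term_of L) ts].
Proof. by move=> Lt; inversion Lt. Qed.

Lemma sub_free_vars (V : vocabulary) (F : formula V) x :
  x \in free F -> x \in vars F.
Proof.
elim: F x => [s t|p ts|F IH|F IHF G IHG|F IHF G IHG|F IHF G IHG|F IHF G IHG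
       |y F IH|y F IH] x //=; first exact: IH.
1-4: by rewrite !mem_cat => /orP[/IHF->|/IHG->]; rewrite ?orbT.
all: by rewrite mem_filter inE => /andP[_ /IH->]; rewrite orbT.
Qed.

Lemma fresh_leq (s : seq nat) n x : sumn s <= n -> x \in s -> x <= n.
Proof.
elim: s => //= y s IH /[swap]; rewrite inE => /orP[/eqP->|xs] le_n.
  exact: leq_trans (leq_addr _ _) le_n.
by apply: IH xs; apply: leq_trans (leq_addl _ _) le_n.
Qed.

Lemma ltn_notin (s : seq nat) n : sumn s < n -> n \notin s.
Proof.
move=> lt_n; apply/negP => /(fresh_leq (leqnn _)).
by rewrite leqNgt lt_n.
Qed.

Lemma fresh_var (s : seq nat) : exists z, z \notin s.
Proof. by exists (sumn s).+1; exact: ltn_notin. Qed.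

(** * Structures and soundness *)

Record structure (V : vocabulary) := Structure {
  dom :> Type;
  ifun : Defs.fsym V -> seq dom -> dom;
  ipred : psym V -> seq dom -> Prop }.

Definition upd (T : Type) (v : nat -> T) (x : nat) (d : T) : nat -> T :=
  fun y => if y == x then d else v y.

Lemma upd_eq (T : Type) (v : nat -> T) x d : upd v x d x = d.
Proof. by rewrite /upd eqxx. Qed.

Lemma upd_neq (T : Type) (v : nat -> T) x y d : y != x -> upd v x d y = v y.
Proof. by rewrite /upd => /negPf->. Qed.

Lemma upd_id (T : Type) (v : nat -> T) x : upd v x (v x) = v.
Proof. by apply: funext => y; rewrite /upd; case: eqP => [->|]. Qed.

Lemma upd_upd (T : Type) (v : nat -> T) x d e : upd (upd v x d) x e = upd v x e.
Proof. by apply: funext => y; rewrite /upd; case: eqP. Qed.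

Lemma updC (T : Type) (v : nat -> T) x y d e : x != y ->
  upd (upd v x d) y e = upd (upd v y e) x d.
Proof.
move=> /negPf xy; apply: funext => z; rewrite /upd.
by case: (eqVneq z x) => [->|]; rewrite ?xy.
Qed.

Lemma upd_comp (T U : Type) (h : T -> U) (v : nat -> T) x d :
  h \o upd v x d = upd (h \o v) x (h d).
Proof. by apply: funext => y; rewrite /upd /=; case: eqP. Qed.

Fixpoint eval (V : vocabulary) (S : structure V) (v : nat -> S) (t : term V) :
    S :=
  match t with
  | Var x => v x
  | App f ts => ifun f (map (eval v) ts)
  end.

Fixpoint sat (V : vocabulary) (S : structure V) (v : nat -> S)
    (F : formula V) : Prop :=
  match F with
  | Eq s t => eval v s = eval v t
  | Rel p ts => ipred p (map (eval v) ts)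
  | Neg G => ~ sat v G
  | Imp G H => sat v G -> sat v H
  | And G H => sat v G /\ sat v H
  | Or G H => sat v G \/ sat v H
  | Iff G H => sat v G <-> sat v H
  | All x G => forall d : S, sat (upd v x d) G
  | Ex x G => exists d : S, sat (upd v x d) G
  end.

Definition model (V : vocabulary) (M : system V) (S : structure V) : Prop :=
  forall F, basis M F -> forall v : nat -> S, sat v F.

Lemma eq_eval (V : vocabulary) (S : structure V) (v w : nat -> S) t :
  (forall x, x \in tvars t -> v x = w x) -> eval v t = eval w t.
Proof.
elim/term_nested_ind: t => [x|f ts IH] /= vw; first by apply: vw; rewrite inE.
by congr ifun; apply: eq_map_Forall; apply: Forall_tvars IH vw.
Qed.

Lemma eq_evals (V : vocabulary) (S : structure V) (v w : nat -> S) ts :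
  (forall x, x \in flatten (map (@tvars V) ts) -> v x = w x) ->
  map (eval v) ts = map (eval w) ts.
Proof.
move=> vw; apply: eq_map_Forall; apply: Forall_tvars vw.
by elim: ts => // t ts IH; constructor=> // vw; apply: eq_eval.
Qed.

Lemma eq_sat (V : vocabulary) (S : structure V) (v w : nat -> S) F :
  (forall x, x \in free F -> v x = w x) -> sat v F = sat w F.
Proof.
elim: F v w => [s t|p ts|F IH|F IHF G IHG|F IHF G IHG|F IHF G IHG|F IHF G IHG
       |x F IH|x F IH] v w /= vw.
- by congr (_ = _); apply: eq_eval => x xs; apply: vw; rewrite mem_cat xs ?orbT.
- by rewrite (eq_evals vw).
- by rewrite (IH v w).
1-4: by rewrite (IHF v w) ?(IHG v w) // => x xF; apply: vw;
  rewrite mem_cat xF ?orbT.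
all: have E d : sat (upd v x d) F = sat (upd w x d) F by
  apply: IH => y yF; rewrite /upd; case: ifPn => // yx; apply: vw;
  rewrite mem_filter yx.
- by apply: propext; split=> H d; move: (H d); rewrite E.
- by apply: propext; split=> -[d H]; exists d; move: H; rewrite E.
Qed.

Lemma sat_upd_notin (V : vocabulary) (S : structure V) (v : nat -> S) F x d :
  x \notin free F -> sat (upd v x d) F = sat v F.
Proof.
move=> xF; apply: eq_sat => y yF; apply: upd_neq.
by apply: contraNneq xF => <-.
Qed.

Lemma eval_tsubst (V : vocabulary) (S : structure V) (v : nat -> S) x t s :
  eval v (tsubst x t s) = eval (upd v x (eval v t)) s.
Proof.
elim/term_nested_ind: s => [y|f ts IH] /=; first by rewrite /upd; case: eqP.
by congr ifun; rewrite -map_comp; apply: eq_map_Forall.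
Qed.

Lemma tsubst_notin (V : vocabulary) x (t s : term V) :
  x \notin tvars s -> tsubst x t s = s.
Proof.
elim/term_nested_ind: s => [y|f ts IH] /=.
  by rewrite inE eq_sym => /negPf->.
move=> xts; congr App; rewrite -[RHS]map_id; apply: eq_map_Forall.
by elim: IH xts => //= s ss Hs _ IHss; rewrite mem_cat negb_or => /andP[/Hs ? /IHss];
  constructor.
Qed.

Lemma tsubsts_notin (V : vocabulary) x (t : term V) ts :
  x \notin flatten (map (@tvars V) ts) -> map (tsubst x t) ts = ts.
Proof.
elim: ts => //= s ts IH; rewrite mem_cat negb_or => /andP[xs /IH->].
by rewrite tsubst_notin.
Qed.

Lemma subst_notin (V : vocabulary) x (t : term V) F :
  x \notin free F -> subst x t F = F.
Proof.
elim: F => [r s|p ts|F IH|F IHF G IHG|F IHF G IHG|F IHF G IHG|F IHF G IHG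
       |y F IH|y F IH] /=.
- by rewrite mem_cat negb_or => /andP[? ?]; rewrite !tsubst_notin.
- by move=> xts; rewrite tsubsts_notin.
- by move=> /IH->.
1-4: by rewrite mem_cat negb_or => /andP[/IHF-> /IHG->].
all: by rewrite mem_filter eq_sym; case: eqP => //= _ /IH->.
Qed.

Lemma sat_subst (V : vocabulary) (S : structure V) (v : nat -> S) x t F :
  collision_free x t F -> sat v (subst x t F) = sat (upd v x (eval v t)) F.
Proof.
elim: F v => [r s|p ts|F IH|F IHF G IHG|F IHF G IHG|F IHF G IHG|F IHF G IHG
       |y F IH|y F IH] v /=.
- by rewrite !eval_tsubst.
- move=> _; rewrite -map_comp; congr ipred; apply: eq_map => s /=.
  exact: eval_tsubst.
- by move=> /IH->.
1-4: by move=> /andP[/IHF-> /IHG->].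
all: case: (eqVneq y x) => [->|yx] cf.
1: by apply: eq_forall => d; rewrite upd_upd.
2: by apply: eq_exists => d; rewrite upd_upd.
1: rewrite -[LHS]/(forall d, sat (upd v y d) (subst x t F)); apply: eq_forall => d.
2: rewrite -[LHS]/(exists d, sat (upd v y d) (subst x t F)); apply: eq_exists => d.
all: rewrite updC 1?eq_sym //; case/orP: cf => [xF|/andP[yt cf]];
  last by rewrite IH //; congr (sat (upd (upd v y d) x _) F); apply: eq_eval => z zt;
    apply: upd_neq; apply: contraNneq yt => <-.
all: have {}xF : x \notin free F by move: xF; rewrite mem_filter eq_sym yx.
all: by rewrite subst_notin //; symmetry; apply: (sat_upd_notin (upd v y d)).
Qed.

Lemma peval_sat (V : vocabulary) (S : structure V) (v : nat -> S) F :
  peval (fun G => `[< sat v G >]) F = `[< sat v F >].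
Proof.
elim: F => //= [F ->|F -> G ->|F -> G ->|F -> G ->|F -> G ->].
- by rewrite asbool_neg.
- by rewrite asbool_imply.
- by rewrite asbool_and.
- by rewrite asbool_or.
- apply/eqP/asboolP => [E|/propext-> //].
  by split=> /asboolP H; apply/asboolP; rewrite ?E // -E.
Qed.

Lemma sat_eqs_imp (V : vocabulary) (S : structure V) (v : nat -> S) ss ts F :
  size ss = size ts ->
  (map (eval v) ss = map (eval v) ts -> sat v F) -> sat v (eqs_imp ss ts F).
Proof.
elim: ss ts F => [|s ss IH] [|t ts] //= F.
  by move=> _; apply.
by move=> [sz] HF E; apply: IH => // E'; apply: HF; rewrite E E'.
Qed.

Theorem soundness (V : vocabulary) (M : system V) (S : structure V) F :
  model M S -> provable M F -> forall v : nat -> S, sat v F.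
Proof.
move=> SM; elim=> {F} [F []|F|F G _ IHF _ IHG|x t F _ IH _ cf|x F _ IH] /=.
- by move=> {}F _ tF v; apply/asboolP; rewrite -peval_sat.
- by move=> x {}F _ v /(_ (v x)); rewrite upd_id.
- by move=> x {}F G _ _ xF v H satF d; apply: H; rewrite sat_upd_notin.
- by move=> x {}F _ v; split=> [[d H]|/existsNP[d /contrapT H]];
    [move/(_ d)|exists d].
- by [].
- by move=> s1 s2 t1 t2 _ _ v -> ->.
- move=> f ss ts /term_of_AppE[_ szs _] /term_of_AppE[_ szt _] v.
  by apply: sat_eqs_imp => [|/= ->] //; rewrite szs szt.
- move=> p ss ts [_ szs _] [_ szt _] v.
  by apply: sat_eqs_imp => [|/= ->] //; rewrite szs szt.
- by move=> BF v; apply: SM.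
- by move=> v; exact: IHG (IHF v).
- by move=> v; rewrite sat_subst.
- by move=> v d; apply: IH.
Qed.

(** * Renaming of variables *)

Fixpoint trename (V : vocabulary) (r : nat -> nat) (t : term V) : term V :=
  match t with
  | Var x => Var (r x)
  | App f ts => App f (map (trename r) ts)
  end.

(** Bound variables are renamed by [b], free ones by [r]. *)
Fixpoint rename (V : vocabulary) (b r : nat -> nat) (F : formula V) :
    formula V :=
  match F with
  | Eq s t => Eq (trename r s) (trename r t)
  | Rel p ts => Rel p (map (trename r) ts)
  | Neg G => Neg (rename b r G)
  | Imp G H => Imp (rename b r G) (rename b r H)
  | And G H => And (rename b r G) (rename b r H)
  | Or G H => Or (rename b r G) (rename b r H)
  | Iff G H => Iff (rename b r G) (rename b r H)
  | All x G => All (b x) (rename b (upd r x (b x)) G)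
  | Ex x G => Ex (b x) (rename b (upd r x (b x)) G)
  end.

(** Satisfied by axiom schemes stated for all choices of distinct variables. *)
Definition renaming_stable (V : vocabulary) (M : system V) : Prop :=
  forall f, injective f -> forall F, basis M F -> basis M (rename f f F).

Lemma eq_trename (V : vocabulary) (r r' : nat -> nat) (t : term V) :
  (forall x, x \in tvars t -> r x = r' x) -> trename r t = trename r' t.
Proof.
elim/term_nested_ind: t => [x|f ts IH] /= rr'; first by rewrite rr' ?inE.
by congr App; apply: eq_map_Forall; apply: Forall_tvars IH rr'.
Qed.

Lemma eq_trenames (V : vocabulary) (r r' : nat -> nat) (ts : seq (term V)) :
  (forall x, x \in flatten (map (@tvars V) ts) -> r x = r' x) ->
  map (trename r) ts = map (trename r') ts.
Proof.
move=> rr'; apply: eq_map_Forall; apply: Forall_tvars rr'.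
by elim: ts => // t ts IH; constructor=> // rr'; apply: eq_trename.
Qed.

Lemma eq_rename (V : vocabulary) (b r r' : nat -> nat) (F : formula V) :
  (forall x, x \in free F -> r x = r' x) -> rename b r F = rename b r' F.
Proof.
elim: F r r' => [s t|p ts|F IH|F IHF G IHG|F IHF G IHG|F IHF G IHG|F IHF G IHG
       |x F IH|x F IH] r r' /= rr'.
- by congr Eq; apply: eq_trename => x xs; apply: rr'; rewrite mem_cat xs ?orbT.
- by rewrite (eq_trenames rr').
- by rewrite (IH r r').
1-4: by rewrite (IHF r r') ?(IHG r r') // => x xF; apply: rr';
  rewrite mem_cat xF ?orbT.
all: congr (_ _); apply: IH => y yF; rewrite /upd; case: ifPn => // yx.
all: by apply: rr'; rewrite mem_filter yx.
Qed.

Lemma trename_comp (V : vocabulary) (r r' : nat -> nat) (t : term V) :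
  trename r' (trename r t) = trename (r' \o r) t.
Proof.
elim/term_nested_ind: t => [x|f ts IH] //=.
by congr App; rewrite -map_comp; apply: eq_map_Forall.
Qed.

Lemma trename_id (V : vocabulary) (t : term V) : trename id t = t.
Proof.
elim/term_nested_ind: t => [x|f ts IH] //=.
by congr App; rewrite -[RHS]map_id; apply: eq_map_Forall.
Qed.

Lemma rename_comp (V : vocabulary) (f g : nat -> nat) (F : formula V) :
  rename g g (rename f f F) = rename (g \o f) (g \o f) F.
Proof.
elim: F => [s t|p ts|F IH|F IHF G IHG|F IHF G IHG|F IHF G IHG|F IHF G IHG
       |x F IH|x F IH] /=; rewrite ?upd_id ?IH ?IHF ?IHG //.
- by rewrite !trename_comp.
- by rewrite -map_comp; congr Rel; apply: eq_map => t; exact: trename_comp.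
Qed.

Lemma rename_id_on (V : vocabulary) (f : nat -> nat) (F : formula V) :
  (forall x, x \in vars F -> f x = x) -> rename f f F = F.
Proof.
have tid r (t : term V) : (forall x, x \in tvars t -> r x = x) -> trename r t = t.
  by move=> rx; rewrite (eq_trename rx) trename_id.
elim: F => [s t|p ts|F IH|F IHF G IHG|F IHF G IHG|F IHF G IHG|F IHF G IHG
       |x F IH|x F IH] /= fx.
- by rewrite !tid // => x xs; apply: fx; rewrite mem_cat xs ?orbT.
- rewrite (eq_trenames fx); congr Rel; rewrite -[RHS]map_id.
  by apply: eq_map => t; exact: trename_id.
- by rewrite IH.
1-4: by rewrite IHF ?IHG // => x xF; apply: fx; rewrite mem_cat xF ?orbT.
all: rewrite upd_id IH ?fx ?mem_head // => y yF; apply: fx.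
all: by rewrite inE yF orbT.
Qed.

Lemma trename_tvars (V : vocabulary) (f : nat -> nat) (t : term V) :
  tvars (trename f t) = map f (tvars t).
Proof.
elim/term_nested_ind: t => [x|g ts IH] //=.
rewrite map_flatten -!map_comp; congr flatten; exact: eq_map_Forall.
Qed.

Lemma trenames_tvars (V : vocabulary) (f : nat -> nat) (ts : seq (term V)) :
  flatten (map (@tvars V) (map (trename f) ts)) =
  map f (flatten (map (@tvars V) ts)).
Proof.
rewrite map_flatten -!map_comp; congr flatten; apply: eq_map => t.
exact: trename_tvars.
Qed.

Lemma free_rename (V : vocabulary) (f : nat -> nat) (F : formula V) :
  injective f -> free (rename f f F) = map f (free F).
Proof.
move=> fI; elim: F => [s t|p ts|F IH|F IHF G IHG|F IHF G IHG|F IHF G IHG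
       |F IHF G IHG|x F IH|x F IH] //=; rewrite ?map_cat ?IHF ?IHG //.
- by rewrite !trename_tvars.
- exact: trenames_tvars.
all: rewrite upd_id IH filter_map; congr map; apply: eq_filter => y /=.
all: by rewrite (inj_eq fI).
Qed.

Lemma term_of_rename (V : vocabulary) (L : language V) r (t : term V) :
  term_of L t -> term_of L (trename r t).
Proof.
elim/term_nested_ind: t => [x|f ts IH] /=; first by move=> _; exact: term_of_Var.
move=> /term_of_AppE[Lf sz Lts]; apply: term_of_App; rewrite ?size_map //.
by apply: Forall_map; apply: Forall_mp IH Lts.
Qed.

Lemma formula_of_rename (V : vocabulary) (L : language V) b r (F : formula V) :
  formula_of L F -> formula_of L (rename b r F).
Proof.
elim: F r => [s t|p ts|F IH|F IHF G IHG|F IHF G IHG|F IHF G IHG|F IHF G IHG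
       |x F IH|x F IH] r /=; do ?by [exact: IH | case=> /IHF FF /IHG].
  by case=> *; split; exact: term_of_rename.
case=> Lp sz Lts; split; rewrite ?size_map //; apply: Forall_map.
by apply: List.Forall_impl Lts => t; exact: term_of_rename.
Qed.

Lemma trename_tsubst (V : vocabulary) f x (t s : term V) : injective f ->
  trename f (tsubst x t s) = tsubst (f x) (trename f t) (trename f s).
Proof.
move=> fI; elim/term_nested_ind: s => [y|g ts IH] /=.
  by rewrite (inj_eq fI); case: eqP.
by congr App; rewrite -!map_comp; apply: eq_map_Forall.
Qed.

Lemma rename_subst (V : vocabulary) f x (t : term V) F : injective f ->
  rename f f (subst x t F) = subst (f x) (trename f t) (rename f f F).
Proof.
move=> fI; elim: F => [r s|p ts|F IH|F IHF G IHG|F IHF G IHG|F IHF G IHG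
       |F IHF G IHG|y F IH|y F IH] //=; rewrite ?IH ?IHF ?IHG ?upd_id //.
- by rewrite !trename_tsubst.
- by congr Rel; rewrite -!map_comp; apply: eq_map => s; exact: trename_tsubst.
all: by rewrite (inj_eq fI); case: eqP => _ /=; rewrite upd_id ?IH.
Qed.

Lemma collision_free_rename (V : vocabulary) f x (t : term V) F :
  injective f -> collision_free x t F ->
  collision_free (f x) (trename f t) (rename f f F).
Proof.
move=> fI; elim: F => [r s|p ts|F IH|F IHF G IHG|F IHF G IHG|F IHF G IHG
       |F IHF G IHG|y F IH|y F IH] //=.
1-4: by move=> /andP[/IHF-> /IHG->].
all: rewrite upd_id free_rename // trename_tvars mem_map //.
all: rewrite !mem_filter (inj_eq fI) mem_map //.
all: by case/orP => [->//|/andP[-> /IH->]]; rewrite orbT.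
Qed.

Lemma rename_eqs_imp (V : vocabulary) f (ss ts : seq (term V)) F :
  rename f f (eqs_imp ss ts F) =
  eqs_imp (map (trename f) ss) (map (trename f) ts) (rename f f F).
Proof.
rewrite /eqs_imp; elim: ss ts => [|s ss IH] [|t ts] //=.
by rewrite IH.
Qed.

Lemma peval_rename (V : vocabulary) f (v : formula V -> bool) F :
  peval v (rename f f F) = peval (v \o rename f f) F.
Proof.
by elim: F => //= [F ->|F -> G ->|F -> G ->|F -> G ->|F -> G ->].
Qed.

Lemma provable_rename (V : vocabulary) (M : system V) f F :
  renaming_stable M -> injective f -> provable M F ->
  provable M (rename f f F).
Proof.
move=> MR fI; elim=> {F} [F LF|F BF|F G _ IHF _ IHG|x t F _ IH Mt cf|x F _ IH].
- apply: Pr_logical; case: LF => [{}F MF tF|x {}F MF|x {}F G MF MG xF|x {}F MF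
    |t Mt|s1 s2 t1 t2 Ms Mt|g ss ts Ms Mt|p ss ts Ms Mt] /=; rewrite ?upd_id.
  + by apply: Ax_taut; [exact: formula_of_rename|move=> v; rewrite peval_rename].
  + exact/Ax_all_elim/formula_of_rename.
  + apply: Ax_all_imp; rewrite ?free_rename ?mem_map //; exact: formula_of_rename.
  + exact/Ax_ex/formula_of_rename.
  + exact/Ax_eq_refl/term_of_rename.
  + apply: Ax_eq_eq.
      exact: (formula_of_rename f f Ms).
    exact: (formula_of_rename f f Mt).
  + rewrite rename_eqs_imp; apply: Ax_eq_fun; [move: Ms|move: Mt] => /term_of_rename.
      exact.
    exact.
  + rewrite rename_eqs_imp; apply: Ax_eq_pred.
      exact: (formula_of_rename f f Ms).
    exact: (formula_of_rename f f Mt).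
- exact/Pr_basis/MR.
- exact: Pr_mp IHF IHG.
- rewrite rename_subst //; apply: Pr_subst => //; first exact: term_of_rename.
  exact: collision_free_rename.
- by rewrite /= upd_id; exact: Pr_gen.
Qed.

(** ** Separating bound variables from parameters *)

Lemma double_inj : injective double.
Proof. exact: (can_inj doubleK). Qed.

(** The doubled formula can be renamed back: an injection that halves the
   finitely many even variables at stake exists. *)
Lemma provable_undouble (V : vocabulary) (M : system V) F :
  renaming_stable M -> provable M (rename double double F) -> provable M F.
Proof.
move=> MR; pose N := (sumn (vars F)).+1.
(* [g] halves the even numbers below [N.*2] and shifts the others by [N]. *)
pose g n := if ~~ odd n && (n./2 < N) then n./2 else n + N.
have gI : injective g.
  move=> m n; rewrite /g.
  case: ifPn => [/andP[em mN]|_]; case: ifPn => [/andP[en nN]|_] E.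
  - by rewrite -(even_halfK em) -(even_halfK en) E.
  - by move: mN; rewrite E ltnNge leq_addl.
  - by move: nN; rewrite -E ltnNge leq_addl.
  - by move/eqP: E; rewrite eqn_add2r => /eqP.
move=> /(provable_rename MR gI); rewrite rename_comp rename_id_on // => x xF /=.
by rewrite /g odd_double doubleK ltnS (fresh_leq (leqnn _) xF).
Qed.

Lemma collision_free_odd (V : vocabulary) x k r (F : formula V) :
  collision_free x (Var k.*2.+1) (rename double r F).
Proof.
elim: F r => [s t|p ts|F IH|F IHF G IHG|F IHF G IHG|F IHF G IHG|F IHF G IHG
       |y F IH|y F IH] r //=; rewrite ?IHF ?IHG //.
all: rewrite IH inE andbT; apply/orP; right; apply/eqP => /(congr1 odd).
all: by rewrite /= !odd_double.
Qed.

Lemma tsubst_trename (V : vocabulary) r x k (t : term V) :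
  r x = x.*2 -> (forall y, r y = x.*2 -> y = x) ->
  tsubst x.*2 (Var k) (trename r t) = trename (upd r x k) t.
Proof.
move=> rx rI; elim/term_nested_ind: t => [y|f ts IH] /=.
  by rewrite /upd; case: (eqVneq y x) => [->|/eqP yx];
    [rewrite rx eqxx|case: eqP => // /rI].
by congr App; rewrite -!map_comp; apply: eq_map_Forall.
Qed.

(** A collision cannot occur when the bound variables are even and the
   parameters odd; this is why the instances of a doubled formula are again
   renamings of the original formula. *)
Lemma subst_rename (V : vocabulary) r x k (F : formula V) :
  r x = x.*2 -> (forall y, r y = x.*2 -> y = x) ->
  subst x.*2 (Var k) (rename double r F) = rename double (upd r x k) F.
Proof.
move=> rx rI; elim: F r rx rI => [s t|p ts|F IH|F IHF G IHG|F IHF G IHG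
       |F IHF G IHG|F IHF G IHG|y F IH|y F IH] r rx rI /=;
  rewrite ?IHF ?IHG //.
- by rewrite !tsubst_trename.
- by rewrite -map_comp; congr Rel; apply: eq_map => t; exact: tsubst_trename.
- by rewrite IH.
all: rewrite (inj_eq double_inj); case: (eqVneq y x) => [->|yx].
1, 3: by rewrite upd_upd.
all: rewrite IH ?(updC _ _ _ yx) //; first by rewrite upd_neq // eq_sym.
all: move=> z; rewrite /upd; case: eqP => [-> /double_inj/eqP|_ /rI //].
all: by rewrite (negPf yx).
Qed.

(** As collisions cannot occur, odd parameters may be put for the free variables
   of a provable formula one after the other. *)
Lemma provable_params (V : vocabulary) (M : system V) (s : nat -> nat) F :
  renaming_stable M -> provable M F ->
  provable M (rename double (fun x => (s x).*2.+1) F).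
Proof.
(* Below [n] the variables have been replaced by parameters. *)
move=> MR MF; pose r n x := if x < n then (s x).*2.+1 else x.*2.
have Mr n : provable M (rename double (r n) F).
  elim: n => [|n IH]; first exact: (provable_rename MR double_inj MF).
  have -> : r n.+1 = upd (r n) n (s n).*2.+1.
    by apply: funext => x; rewrite /r /upd ltnS leq_eqVlt; case: eqP => [->|].
  rewrite -subst_rename.
  - by apply: Pr_subst => //; [exact: term_of_Var|exact: collision_free_odd].
  - by rewrite /r ltnn.
  move=> y; rewrite /r; case: ifP => _; last exact: double_inj.
  by move=> /(congr1 odd); rewrite /= !odd_double.
rewrite (@eq_rename _ _ _ (r (sumn (free F)).+1)) // => x xF.
by rewrite /r ltnS (fresh_leq (leqnn _) xF).
Qed.

(** * Derived rules *)

Lemma term_of_tsubst (V : vocabulary) (L : language V) x t s :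
  term_of L t -> term_of L s -> term_of L (tsubst x t s).
Proof.
move=> Lt; elim/term_nested_ind: s => [y|f ts IH] /=; first by case: ifP.
move=> /term_of_AppE[Lf sz Lts]; apply: term_of_App; rewrite ?size_map //.
by apply: Forall_map; apply: Forall_mp IH Lts.
Qed.

Lemma formula_of_subst (V : vocabulary) (L : language V) x t F :
  term_of L t -> formula_of L F -> formula_of L (subst x t F).
Proof.
move=> Lt.
elim: F => [s s'|p ts|F IH|F IHF G IHG|F IHF G IHG|F IHF G IHG|F IHF G IHG
       |y F IH|y F IH] //=; do ?by [case=> /IHF FF /IHG | case: ifP => //= _ /IH].
  by case=> *; split; exact: term_of_tsubst.
case=> Lp sz Lts; split; rewrite ?size_map //; apply: Forall_map.
by apply: List.Forall_impl Lts => s; exact: term_of_tsubst.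
Qed.

Lemma formula_of_eqs_imp (V : vocabulary) (L : language V) ss ts F :
  List.Forall (term_of L) ss -> List.Forall (term_of L) ts ->
  formula_of L F -> formula_of L (eqs_imp ss ts F).
Proof.
move=> Lss Lts LF; elim: Lss ts Lts => [|s {}ss Ls _ IH] [|t ts] //.
by move=> /List.Forall_cons_iff[Lt /IH].
Qed.

Lemma provable_wf (V : vocabulary) (M : system V) F :
  provable M F -> formula_of M F.
Proof.
elim=> {F} [F [{}F MF tF|x {}F MF|x {}F G MF MG xF|x {}F MF
    |t Mt|s1 s2 t1 t2 Ms Mt|g ss ts Ms Mt|p ss ts Ms Mt]||F G _ _ _ []
    |x t F _ IH Mt _|] //=.
- by case: Ms => *; case: Mt.
- have [_ _ Mss] := term_of_AppE Ms; have [_ _ Mts] := term_of_AppE Mt.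
  exact: formula_of_eqs_imp.
- by case: (Ms) (Mt) => _ _ Mss [_ _ Mts]; exact: formula_of_eqs_imp.
- exact: basis_wf.
- exact: formula_of_subst.
Qed.

Lemma provable_taut1 (V : vocabulary) (M : system V) F G :
  tautology (F →' G) -> formula_of M G -> provable M F -> provable M G.
Proof.
move=> tFG MG MF; apply: (Pr_mp MF); apply/Pr_logical/Ax_taut => //=.
by split=> //; exact: provable_wf MF.
Qed.

Lemma provable_taut2 (V : vocabulary) (M : system V) F G H :
  tautology (F →' (G →' H)) -> formula_of M H ->
  provable M F -> provable M G -> provable M H.
Proof.
move=> tFGH MH MF MG; apply: (Pr_mp MG); apply: (provable_taut1 tFGH _ MF).
by split=> //; exact: provable_wf MG.
Qed.

(** Decides a tautology by cases on the truth values of its components. *)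
Ltac taut := move=> ? /=; repeat match goal with
  | |- context [peval ?v ?F] => case: (peval v F)
  | v : formula _ -> bool |- context [?w ?F] => constr_eq v w; case: (w F)
  end; by [].

Lemma provable_trans (V : vocabulary) (M : system V) F G H :
  provable M (F →' G) -> provable M (G →' H) -> provable M (F →' H).
Proof.
move=> FG GH; apply: (provable_taut2 _ _ FG GH); first by taut.
by split; [case: (provable_wf FG)|case: (provable_wf GH)].
Qed.

Lemma provable_imp_all (V : vocabulary) (M : system V) x F G :
  x \notin free F -> provable M (F →' G) -> provable M (F →' ∀' x, G).
Proof.
move=> xF FG; have [MF MG] := provable_wf FG.
by apply: Pr_mp (Pr_gen x FG) _; apply/Pr_logical/Ax_all_imp.
Qed.

Lemma tsubst_back (V : vocabulary) x z (t : term V) : z \notin tvars t ->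
  tsubst z (Var x) (tsubst x (Var z) t) = t.
Proof.
elim/term_nested_ind: t => [y|f ts IH] /=.
  rewrite inE => zy; case: (eqVneq y x) => [->|_] /=; first by rewrite eqxx.
  by rewrite eq_sym (negPf zy).
move=> zts; congr App; rewrite -map_comp -[RHS]map_id; apply: eq_map_Forall.
by elim: IH zts => //= t {}ts Ht _ IH; rewrite mem_cat negb_or => /andP[/Ht ? /IH];
  constructor.
Qed.

Lemma tsubsts_back (V : vocabulary) x z (ts : seq (term V)) :
  z \notin flatten (map (@tvars V) ts) ->
  map (tsubst z (Var x)) (map (tsubst x (Var z)) ts) = ts.
Proof.
elim: ts => //= t ts IH; rewrite mem_cat negb_or => /andP[zt /IH->].
by rewrite tsubst_back.
Qed.

Lemma subst_back (V : vocabulary) x z (F : formula V) : z \notin vars F ->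
  subst z (Var x) (subst x (Var z) F) = F.
Proof.
elim: F => [s t|p ts|F IH|F IHF G IHG|F IHF G IHG|F IHF G IHG|F IHF G IHG
       |y F IH|y F IH] //=.
- by rewrite mem_cat negb_or => /andP[zs zt]; rewrite !tsubst_back.
- by move=> zts; rewrite tsubsts_back.
- by move=> /IH->.
1-4: by rewrite mem_cat negb_or => /andP[/IHF-> /IHG->].
all: rewrite inE negb_or eq_sym => /andP[/negPf zy zF].
all: case: (eqVneq y x) => _ /=; rewrite zy ?IH //.
all: by rewrite subst_notin //; apply: contra zF; exact: sub_free_vars.
Qed.

Lemma collision_free_back (V : vocabulary) x z (F : formula V) :
  z \notin vars F -> collision_free z (Var x) (subst x (Var z) F).
Proof.
elim: F => [s t|p ts|F IH|F IHF G IHG|F IHF G IHG|F IHF G IHG|F IHF G IHG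
       |y F IH|y F IH] //=.
1-4: by rewrite mem_cat negb_or => /andP[/IHF-> /IHG->].
all: rewrite inE negb_or => /andP[zy zF].
all: case: (eqVneq y x) => [_|yx] /=; last by rewrite inE yx IH ?orbT.
all: rewrite mem_filter zy /=; apply/orP; left; apply: contra zF.
all: exact: sub_free_vars.
Qed.

Lemma tsubst_tvars (V : vocabulary) x z (t : term V) :
  x != z -> x \notin tvars (tsubst x (Var z) t).
Proof.
move=> xz; elim/term_nested_ind: t => [y|f ts IH] /=.
  by case: (eqVneq y x) => [_|yx]; rewrite inE // eq_sym.
by elim: IH => //= t {}ts xt _ IH; rewrite mem_cat negb_or xt.
Qed.

Lemma free_subst (V : vocabulary) x z (F : formula V) :
  x != z -> x \notin free (subst x (Var z) F).
Proof.
move=> xz.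
elim: F => [s t|p ts|F IH|F IHF G IHG|F IHF G IHG|F IHF G IHG|F IHF G IHG
       |y F IH|y F IH] //=.
- by rewrite mem_cat negb_or !tsubst_tvars.
- by elim: ts => //= t ts IH; rewrite mem_cat negb_or tsubst_tvars.
1-4: by rewrite mem_cat negb_or IHF.
all: by case: (eqVneq y x) => [->|yx] /=;
  rewrite mem_filter ?eqxx // (negPf IH) andbF.
Qed.

(** Generalizing an instance at a fresh variable is as good as generalizing the
   formula itself: substituting the old variable back recovers it. *)
Lemma provable_all_subst (V : vocabulary) (M : system V) x z F :
  formula_of M F -> z \notin vars F -> x != z ->
  provable M ((∀' z, subst x (Var z) F) →' ∀' x, F).
Proof.
move=> MF zF xz; apply: provable_imp_all.
  by rewrite /= mem_filter (negPf (free_subst _ xz)) andbF.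
have MG : formula_of M (subst x (Var z) F).
  by apply: formula_of_subst => //; exact: term_of_Var.
have := Pr_logical (Ax_all_elim z MG).
move=> /(Pr_subst (x := z) (t := Var x)) /=; rewrite eqxx subst_back //; apply.
  exact: term_of_Var.
by rewrite mem_filter eqxx /= collision_free_back.
Qed.

(** * Maximal consistent sets with witnesses *)

Definition consistent (V : vocabulary) (M : system V) (F : formula V) : Prop :=
  formula_of M F /\ ~ provable M (¬' F).

Definition enumerable (V : vocabulary) (L : language V) : Prop :=
  exists e : nat -> formula V, forall F, formula_of L F -> exists n, e n = F.

(** An odd variable, so that it stays apart from the bound variables of
   formulas renamed by [double]; exceeding a sum, it is fresh. *)
Definition witness (V : vocabulary) (C F : formula V) : term V :=
  Var (sumn (vars C ++ vars F)).*2.+1.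

(** A formula whose addition is inconsistent is already refuted by [C], so its
   negation need not be added; a universal one still needs a counterexample. *)
Definition henkin_step (V : vocabulary) (M : system V) (C F : formula V) :
    formula V :=
  if `[< consistent M (C ∧' F) >] then C ∧' F
  else match F with
    | All x G =>
        if `[< formula_of M G >] then C ∧' ¬' (subst x (witness C F) G) else C
    | _ => C
    end.

Lemma witness_notin (V : vocabulary) (C F : formula V) :
  (sumn (vars C ++ vars F)).*2.+1 \notin vars C ++ vars F.
Proof. by apply: ltn_notin; rewrite ltnS -addnn leq_addr. Qed.

Lemma inconsistent_imp (V : vocabulary) (M : system V) C F :
  formula_of M C -> formula_of M F -> ~ consistent M (C ∧' F) ->
  provable M (C →' ¬' F).
Proof.
move=> MC MF nCF; have : provable M (¬' (C ∧' F)).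
  by apply: contrapT => nP; apply: nCF.
by apply: provable_taut1 => //; taut.
Qed.

(** If [C] refutes [∀x F] then it is consistent with a counterexample: a proof
   of the instance at a fresh variable would generalize. *)
Lemma consistent_witness (V : vocabulary) (M : system V) C x F :
  consistent M C -> formula_of M F -> provable M (C →' ¬' (∀' x, F)) ->
  consistent M (C ∧' ¬' (subst x (witness C (∀' x, F)) F)).
Proof.
set z := witness _ _; move=> [MC nC] MF CnF.
have /= := witness_notin C (∀' x, F).
rewrite mem_cat inE !negb_or => /and3P[zC zx zF].
have MG : formula_of M (subst x z F).
  by apply: formula_of_subst => //; exact: term_of_Var.
split=> // P; apply: nC.
have CG : provable M (C →' subst x z F).
  by apply: provable_taut1 P => //; taut.
have CF : provable M (C →' ∀' x, F).
  apply: (@provable_trans _ _ _ (∀' (sumn (vars C ++ vars (∀' x, F))).*2.+1,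
    subst x z F)).
    by apply: provable_imp_all CG; apply: contra zC; exact: sub_free_vars.
  by apply: provable_all_subst => //; rewrite eq_sym.
by apply: provable_taut2 CnF CF => //; taut.
Qed.

Lemma consistent_step (V : vocabulary) (M : system V) C F :
  consistent M C -> consistent M (henkin_step M C F).
Proof.
move=> cC; rewrite /henkin_step; case: asboolP => // nCF.
case: F nCF => // x F nCF; case: asboolP => // MF.
apply: consistent_witness => //; apply: inconsistent_imp => //.
by case: cC.
Qed.

Lemma provable_and_l (V : vocabulary) (M : system V) F G :
  formula_of M (F ∧' G) -> provable M (F ∧' G →' F).
Proof. by move=> [MF MG]; apply/Pr_logical/Ax_taut => //; taut. Qed.

Lemma provable_and_r (V : vocabulary) (M : system V) F G :
  formula_of M (F ∧' G) -> provable M (F ∧' G →' G).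
Proof. by move=> [MF MG]; apply/Pr_logical/Ax_taut => //; taut. Qed.

Lemma provable_id (V : vocabulary) (M : system V) F :
  formula_of M F -> provable M (F →' F).
Proof. by move=> MF; apply/Pr_logical/Ax_taut => //; taut. Qed.

Lemma henkin_step_imp (V : vocabulary) (M : system V) C F :
  consistent M C -> provable M (henkin_step M C F →' C).
Proof.
move=> cC; have [MC _] := cC.
have [] := consistent_step F cC; rewrite /henkin_step.
case: asboolP => [_ M' _|_]; first exact: provable_and_l.
case: F => [s t|p ts|F|F G|F G|F G|F G|x F|x F] => [||||||||];
  try by move=> _ _; exact: provable_id.
by case: asboolP => _ M' _; [exact: provable_and_l|exact: provable_id].
Qed.

Lemma henkin_step_decides (V : vocabulary) (M : system V) C F :
  consistent M C -> formula_of M F ->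
  provable M (henkin_step M C F →' F) \/ provable M (henkin_step M C F →' ¬' F).
Proof.
move=> cC MF; have [MC _] := cC.
case: (pselect (consistent M (C ∧' F))) => [cCF|nCF].
  by left; rewrite /henkin_step asboolT //; apply: provable_and_r; case: cCF.
right; apply: provable_trans (henkin_step_imp F cC) _.
exact: inconsistent_imp.
Qed.

Lemma henkin_step_witness (V : vocabulary) (M : system V) C x F :
  consistent M C -> formula_of M F ->
  provable M (henkin_step M C (∀' x, F) →' ∀' x, F) \/
  exists k, provable M (henkin_step M C (∀' x, F) →' ¬' subst x (Var k.*2.+1) F).
Proof.
move=> cC MF; have [] := consistent_step (∀' x, F) cC; rewrite /henkin_step.
case: asboolP => [cCF M' _|nCF]; first by left; apply: provable_and_r.
rewrite asboolT //= => M' _; right.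
by exists (sumn (vars C ++ vars (∀' x, F))); exact: provable_and_r.
Qed.

(** What the truth lemma uses of a maximal consistent set with witnesses. *)
Record henkin_set (V : vocabulary) (M : system V) (T : formula V -> Prop) :
    Prop := HenkinSet {
  henkin_provable : forall F, provable M F -> T F;
  henkin_mp : forall F G, T F -> T (F →' G) -> T G;
  henkin_wf : forall F, T F -> formula_of M F;
  henkin_neg : forall F, formula_of M F -> T (¬' F) <-> ~ T F;
  henkin_witness : forall x F, formula_of M F -> ~ T (∀' x, F) ->
    exists k, T (¬' subst x (Var k.*2.+1) F) }.

(** Each stage of the construction is a single formula, hence leaves infinitely
   many variables fresh; the set collects the consequences of all stages. *)
Theorem henkin_extension (V : vocabulary) (M : system V) F :
  enumerable M -> formula_of M F -> ~ provable M F ->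
  exists2 T, henkin_set M T & T (¬' F).
Proof.
move=> [e eP] MF nF.
(* [C n] is the conjunction of the assumptions made before stage [n]. *)
pose C := fix C n := if n is m.+1 then henkin_step M (C m) (e m) else ¬' F.
have cC n : consistent M (C n).
  elim: n => [|n IH]; last exact: consistent_step.
  split=> // P; apply: nF; apply: provable_taut1 P => //; taut.
have MC n : formula_of M (C n) by case: (cC n).
have CS n : provable M (C n.+1 →' C n) by exact: henkin_step_imp.
have Cle m n G : m <= n -> provable M (C m →' G) -> provable M (C n →' G).
  move=> /subnK<- CG; elim: (n - m) => // k IH.
  exact: provable_trans (CS _) IH.
have C2 m n G H : provable M (C m →' G) -> provable M (C n →' H) ->
    exists k, provable M (C k →' G) /\ provable M (C k →' H).
  move=> CG CH; exists (m + n); split; first exact: Cle (leq_addr n m) CG.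
  exact: Cle (leq_addl m n) CH.
exists (fun G => exists n, provable M (C n →' G)); last first.
  by exists 0; exact: provable_id.
have MT n G : provable M (C n →' G) -> formula_of M G.
  by move=> /provable_wf[].
split.
- move=> G PG; exists 0; apply: (provable_taut1 _ _ PG); first by taut.
  by split; [|exact: provable_wf PG].
- move=> G H [m CG] [n CGH]; have [k [kG kGH]] := C2 _ _ _ _ CG CGH.
  exists k; apply: (provable_taut2 _ _ kG kGH); first by taut.
  by split=> //; have [_ []] := provable_wf CGH.
- by move=> G [n /MT].
- move=> G MG; split=> [[m CnG] [n CG]|nG].
    have [k [kG knG]] := C2 _ _ _ _ CG CnG.
    by have [_] := cC k; apply; apply: provable_taut2 kG knG => //; taut.
  have [n en] := eP _ MG; exists n.+1 => /=; rewrite en.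
  case: (henkin_step_decides (cC n) MG) => // P.
  by case: nG; exists n.+1 => /=; rewrite en.
move=> x G MG nG; have [n en] := eP (∀' x, G) MG.
have [P|[k P]] := henkin_step_witness x (cC n) MG.
  by case: nG; exists n.+1; rewrite /= en.
by exists k, n.+1; rewrite /= en.
Qed.

(** * Truth in a Henkin set *)

Lemma henkin_taut (V : vocabulary) (M : system V) T F : henkin_set M T ->
  tautology F -> formula_of M F -> T F.
Proof. by move=> HT tF MF; apply/(henkin_provable HT)/Pr_logical/Ax_taut. Qed.

Lemma henkin_imp (V : vocabulary) (M : system V) T F G : henkin_set M T ->
  formula_of M F -> formula_of M G -> T (F →' G) <-> (T F -> T G).
Proof.
move=> HT MF MG; split=> [FG TF|FG]; first exact: henkin_mp HT _ _ TF FG.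
case: (pselect (T F)) => [/FG TG|/(henkin_neg HT MF) nF].
  by apply: (henkin_mp HT TG); apply: (henkin_taut HT) => //; taut.
by apply: (henkin_mp HT nF); apply: (henkin_taut HT) => //; taut.
Qed.

Lemma henkin_and (V : vocabulary) (M : system V) T F G : henkin_set M T ->
  formula_of M F -> formula_of M G -> T (F ∧' G) <-> T F /\ T G.
Proof.
move=> HT MF MG; have MFG : formula_of M (F ∧' G) by [].
split=> [FG|[TF TG]].
  by split; apply: (henkin_mp HT FG);
    apply: (henkin_provable HT); [exact: provable_and_l|exact: provable_and_r].
apply: (henkin_mp HT TG); apply: (henkin_mp HT TF).
by apply: (henkin_taut HT) => //; taut.
Qed.

Lemma henkin_or (V : vocabulary) (M : system V) T F G : henkin_set M T ->
  formula_of M F -> formula_of M G -> T (F ∨' G) <-> T F \/ T G.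
Proof.
move=> HT MF MG; split=> [FG|[TF|TG]].
- case: (pselect (T F)) => [|/(henkin_neg HT MF) nF]; [by left|right].
  apply: (henkin_mp HT nF); apply: (henkin_mp HT FG).
  by apply: (henkin_taut HT) => //; taut.
- by apply: (henkin_mp HT TF); apply: (henkin_taut HT) => //; taut.
- by apply: (henkin_mp HT TG); apply: (henkin_taut HT) => //; taut.
Qed.

Lemma henkin_iff (V : vocabulary) (M : system V) T F G : henkin_set M T ->
  formula_of M F -> formula_of M G -> T (F ↔' G) <-> (T F <-> T G).
Proof.
move=> HT MF MG.
have E : T (F ↔' G) <-> T ((F →' G) ∧' (G →' F)).
  split=> H; apply: (henkin_mp HT H); apply: (henkin_taut HT) => //; taut.
rewrite E (henkin_and HT) // (henkin_imp HT) // (henkin_imp HT) //.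
Qed.

Lemma henkin_inst (V : vocabulary) (M : system V) T x t F : henkin_set M T ->
  formula_of M F -> term_of M t -> collision_free x t F ->
  T (∀' x, F) -> T (subst x t F).
Proof.
move=> HT MF Mt cf /(henkin_mp HT); apply; apply: (henkin_provable HT).
have := Pr_logical (Ax_all_elim x MF).
move=> /(Pr_subst (x := x) (t := t)) /=; rewrite eqxx; apply=> //.
by rewrite mem_filter eqxx.
Qed.

Lemma henkin_ex (V : vocabulary) (M : system V) T x F : henkin_set M T ->
  formula_of M F -> T (∃' x, F) <-> ~ T (∀' x, ¬' F).
Proof.
move=> HT MF; rewrite -(henkin_neg HT) //.
apply/(@henkin_iff _ _ _ (∃' x, F) (¬' (∀' x, ¬' F)) HT) => //.
by apply/(henkin_provable HT)/Pr_logical/Ax_ex.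
Qed.

Lemma henkin_refl (V : vocabulary) (M : system V) T t : henkin_set M T ->
  term_of M t -> T (Eq t t).
Proof. by move=> HT Mt; apply/(henkin_provable HT)/Pr_logical/Ax_eq_refl. Qed.

Lemma henkin_eq_eq (V : vocabulary) (M : system V) T s1 s2 t1 t2 :
  henkin_set M T -> T (Eq s1 t1) -> T (Eq s2 t2) -> T (Eq s1 s2) -> T (Eq t1 t2).
Proof.
move=> HT E1 E2 E; apply: (henkin_mp HT E); apply: (henkin_mp HT E2).
apply: (henkin_mp HT E1); apply/(henkin_provable HT)/Pr_logical.
have [Ms1 Mt1] := henkin_wf HT E1; have [Ms2 Mt2] := henkin_wf HT E2.
exact: Ax_eq_eq.
Qed.

Lemma henkin_sym (V : vocabulary) (M : system V) T s t : henkin_set M T ->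
  T (Eq s t) -> T (Eq t s).
Proof.
move=> HT E; have [Ms _] := henkin_wf HT E.
exact: (henkin_eq_eq HT E (henkin_refl HT Ms) (henkin_refl HT Ms)).
Qed.

Lemma henkin_trans (V : vocabulary) (M : system V) T s t u : henkin_set M T ->
  T (Eq s t) -> T (Eq t u) -> T (Eq s u).
Proof.
move=> HT st tu; have [Ms _] := henkin_wf HT st.
exact: (henkin_eq_eq HT (henkin_refl HT Ms) tu st).
Qed.

Lemma henkin_eqs (V : vocabulary) (M : system V) T (I : Type)
    (a b : I -> term V) (s : seq I) F : henkin_set M T ->
  List.Forall (fun i => T (Eq (a i) (b i))) s ->
  T (eqs_imp (map a s) (map b s) F) -> T F.
Proof.
by move=> HT; elim=> //= i {}s Ti _ IH /(henkin_mp HT Ti).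
Qed.

Lemma henkin_all (V : vocabulary) (M : system V) T x F : henkin_set M T ->
  formula_of M F -> (forall k, collision_free x (Var k.*2.+1) F) ->
  T (∀' x, F) <-> forall k, T (subst x (Var k.*2.+1) F).
Proof.
move=> HT MF cf; split=> [TF k|TF].
  by apply: (henkin_inst HT _ _ _ TF) => //; exact: term_of_Var.
apply: contrapT => /(henkin_witness HT MF)[k]; have Tk := TF k.
by rewrite (henkin_neg HT) //; exact: (henkin_wf HT Tk).
Qed.

(** Every term is named by a parameter: [∃x x = t] has a witness. *)
Lemma henkin_param (V : vocabulary) (M : system V) T t : henkin_set M T ->
  term_of M t -> exists k, T (Eq (Var k.*2.+1) t).
Proof.
move=> HT Mt; pose x := (sumn (tvars t)).+1.
have xt : x \notin tvars t by exact: ltn_notin.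
have MF : formula_of M (Eq (Var x) t) by split; [exact: term_of_Var|].
have Tt := henkin_refl HT Mt.
have [|k] := @henkin_witness _ _ _ HT x (¬' Eq (Var x) t) MF.
  move=> /(@henkin_inst _ _ _ x t (¬' Eq (Var x) t) HT MF Mt erefl) /=.
  by rewrite eqxx tsubst_notin // (henkin_neg HT).
rewrite /= eqxx tsubst_notin // => TnnE; exists k.
apply: (henkin_mp HT TnnE); apply: (henkin_taut HT); first by taut.
by have := henkin_wf HT TnnE.
Qed.

(** * The term model *)

Definition param_class (V : vocabulary) (T : formula V -> Prop) (k : nat) :
    nat -> Prop :=
  fun j => T (Eq (Var k.*2.+1) (Var j.*2.+1)).

(** Parameters modulo the equations in [T]; a class is the predicate of its
   members, so that equality of elements is true equality. *)
Definition term_dom (V : vocabulary) (T : formula V -> Prop) : Type :=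
  {C : nat -> Prop | exists k, C = param_class T k}.

Definition cls (V : vocabulary) (T : formula V -> Prop) (k : nat) :
    term_dom T :=
  exist _ (param_class T k) (ex_intro _ k erefl).

Definition repr (V : vocabulary) (T : formula V -> Prop) (d : term_dom T) :
    nat :=
  projT1 (cid (proj2_sig d)).

Definition repr_var (V : vocabulary) (T : formula V -> Prop)
    (d : term_dom T) : term V :=
  Var (repr d).*2.+1.

Definition term_model (V : vocabulary) (T : formula V -> Prop) :
    structure V := {|
  dom := term_dom T;
  ifun f ds :=
    cls T (if pselect (exists k, T (Eq (Var k.*2.+1)
                                       (App f (map (@repr_var V T) ds))))
           is left ex then projT1 (cid ex) else 0);
  ipred p ds := T (Rel p (map (@repr_var V T) ds)) |}.

Lemma term_dom_eq (V : vocabulary) (T : formula V -> Prop)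
    (d e : term_dom T) : proj1_sig d = proj1_sig e -> d = e.
Proof. by case: d e => C HC [D HD] /= E; exact: eq_exist. Qed.

Lemma cls_repr (V : vocabulary) (T : formula V -> Prop) (d : term_dom T) :
  cls T (repr d) = d.
Proof.
by apply: term_dom_eq; rewrite /repr; case: cid => k /= ->.
Qed.

Lemma cls_eq (V : vocabulary) (M : system V) T j k : henkin_set M T ->
  cls T j = cls T k <-> T (Eq (Var j.*2.+1) (Var k.*2.+1)).
Proof.
move=> HT; split=> [E|E].
  have := congr1 (fun C : term_dom T => proj1_sig C k) E => /=; rewrite /param_class => ->.
  by apply: (henkin_refl HT _); exact: term_of_Var.
apply: term_dom_eq; apply: funext => i; apply: propext; rewrite /param_class.
by split; apply: (henkin_trans HT _) => //; exact: henkin_sym HT _.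
Qed.

Lemma repr_cls (V : vocabulary) (M : system V) T k : henkin_set M T ->
  T (Eq (repr_var (cls T k)) (Var k.*2.+1)).
Proof. by move=> HT; apply/(cls_eq _ _ HT); rewrite cls_repr. Qed.

Definition odd_params (s : nat -> nat) : nat -> nat := fun x => (s x).*2.+1.

(** The value of a term is the class of the parameters that [T] equates with it. *)
Lemma eval_term_model (V : vocabulary) (M : system V) T (s : nat -> nat) t :
  henkin_set M T -> term_of M t ->
  T (Eq (repr_var (@eval V (term_model T) (cls T \o s) t))
        (trename (odd_params s) t)).
Proof.
move=> HT; elim/term_nested_ind: t => [x|f ts IH] Mt /=; first exact: repr_cls HT.
have [Mf sz Mts] := term_of_AppE Mt; set ds := map _ ts.
have {}IH := Forall_mp IH Mts.
have Mrep (d : term_dom T) : term_of M (repr_var d) by exact: term_of_Var.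
have Mds : term_of M (App f (map (@repr_var V T) ds)).
  apply: term_of_App; rewrite ?size_map //.
  by apply: Forall_map; elim: ds => [|d ds' IHds]; constructor.
case: pselect => [ex|nex]; last by case: nex; exact: henkin_param HT _.
case: cid => k /= kE; apply: (henkin_trans HT (repr_cls k HT) _).
apply: (henkin_trans HT kE _); rewrite /ds -map_comp in Mds *.
apply: (henkin_eqs HT IH); apply/(henkin_provable HT)/Pr_logical.
by apply: Ax_eq_fun => //; exact: term_of_rename Mt.
Qed.

Lemma rel_term_model (V : vocabulary) (M : system V) T (s : nat -> nat) p ts :
  henkin_set M T -> formula_of M (Rel p ts) ->
  T (Rel p (map (@repr_var V T) (map (@eval V (term_model T) (cls T \o s)) ts)))
  <-> T (Rel p (map (trename (odd_params s)) ts)).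
Proof.
move=> HT MF; have [Mp sz Mts] := MF.
have IH : List.Forall (fun t =>
    T (Eq (repr_var (@eval V (term_model T) (cls T \o s) t))
          (trename (odd_params s) t))) ts.
  by apply: List.Forall_impl Mts => t; exact: eval_term_model HT.
have Mds : formula_of M (Rel p (map (@repr_var V T)
    (map (@eval V (term_model T) (cls T \o s)) ts))).
  split; rewrite ?size_map // -map_comp; apply: Forall_map.
  by apply: List.Forall_impl Mts => t _; exact: term_of_Var.
have Mr := formula_of_rename id (odd_params s) MF.
split=> H; apply: (henkin_mp HT H); rewrite -map_comp in Mds *.
  apply: (henkin_eqs HT IH); apply/(henkin_provable HT)/Pr_logical.
  exact: Ax_eq_pred.
have {}IH : List.Forall (fun t => T (Eq (trename (odd_params s) t)
    (repr_var (@eval V (term_model T) (cls T \o s) t)))) ts.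
  by apply: List.Forall_impl IH => t; exact: henkin_sym HT.
apply: (henkin_eqs HT IH); apply/(henkin_provable HT)/Pr_logical.
exact: Ax_eq_pred.
Qed.

(** The truth lemma. At a quantifier, the instances of the renamed formula at
   odd variables are renamings of its matrix by [subst_rename]. *)
Theorem sat_term_model (V : vocabulary) (M : system V) T (s : nat -> nat) F :
  henkin_set M T -> formula_of M F ->
  @sat V (term_model T) (cls T \o s) F <-> T (rename double (odd_params s) F).
Proof.
move=> HT; elim: F s => [t1 t2|p ts|F IH|F IHF G IHG|F IHF G IHG|F IHF G IHG
       |F IHF G IHG|x F IH|x F IH] s /=.
- case=> Mt1 Mt2.
  have E1 := eval_term_model s HT Mt1; have E2 := eval_term_model s HT Mt2.
  set d1 := eval _ t1 in E1 *; set d2 := eval _ t2 in E2 *.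
  rewrite -(@cls_repr V T d1) -(@cls_repr V T d2) (cls_eq _ _ HT).
  split=> E; first exact: henkin_eq_eq HT E1 E2 E.
  by apply: (henkin_eq_eq HT _ _ E); exact: henkin_sym HT _.
- by move=> MF; rewrite (rel_term_model s HT MF).
- by move=> MF; rewrite IH // (henkin_neg HT) //; exact: formula_of_rename.
- move=> [MF MG]; rewrite IHF // IHG // (henkin_imp HT) //;
    exact: formula_of_rename.
- move=> [MF MG]; rewrite IHF // IHG // (henkin_and HT) //;
    exact: formula_of_rename.
- move=> [MF MG]; rewrite IHF // IHG // (henkin_or HT) //;
    exact: formula_of_rename.
- move=> [MF MG]; rewrite IHF // IHG // (henkin_iff HT) //;
    exact: formula_of_rename.
all: move=> MF; pose r := upd (odd_params s) x x.*2.
all: have MrF : formula_of M (rename double r F) by exact: formula_of_rename.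
all: have rx : r x = x.*2 by exact: upd_eq.
all: have rI y : r y = x.*2 -> y = x by
  rewrite /r /upd; case: eqP => // _ /(congr1 odd); rewrite /= !odd_double.
all: have inst k : @sat V (term_model T) (upd (cls T \o s) x (cls T k)) F <->
    T (subst x.*2 (Var k.*2.+1) (rename double r F)) by
  rewrite -upd_comp IH // subst_rename // upd_upd;
  rewrite -[odd_params _]/((fun n => n.*2.+1) \o upd s x k) upd_comp.
- rewrite (henkin_all HT) //; last by move=> k; exact: collision_free_odd.
  split=> [H k|H d]; first by apply/inst.
  by rewrite -(cls_repr d); apply/inst.
rewrite (henkin_ex _ HT) // (henkin_all HT) //; last first.
  by move=> k; exact: (collision_free_odd x.*2 k r (¬' F)).
split=> [[d]|nT].
  by rewrite -(cls_repr d) => /inst Td /(_ (repr d)) /=; rewrite (henkin_neg HT) //;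
    exact: (henkin_wf HT Td).
apply: contrapT => nE; apply: nT => k /=; apply/(henkin_neg HT).
  by apply: formula_of_subst => //; exact: term_of_Var.
by move=> /inst H; apply: nE; exists (cls T k).
Qed.

(** * Completeness *)

(** For a sentence the renaming of the free variables to parameters, which the
   truth lemma requires, has no effect. *)
Lemma completeness_closed (V : vocabulary) (M : system V) F :
  enumerable M -> renaming_stable M -> formula_of M F -> free F = [::] ->
  (forall S : structure V, model M S -> forall v : nat -> S, sat v F) ->
  provable M F.
Proof.
move=> Me Mr MF cF valF; apply: (provable_undouble Mr); apply: contrapT => nF.
have MdF : formula_of M (rename double double F) by exact: formula_of_rename.
have [T HT TnF] := henkin_extension Me MdF nF.
have TM : model M (term_model T).
  move=> B MB v.
  have -> : v = cls T \o (fun x => repr (v x)).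
    by apply: funext => x /=; rewrite cls_repr.
  apply/(sat_term_model _ HT); first exact: basis_wf.
  by apply: (henkin_provable HT); apply: provable_params => //; exact: Pr_basis.
have := valF _ TM (cls T \o id); rewrite (sat_term_model _ HT) //.
rewrite (@eq_rename _ _ _ double) ?cF //.
by move: TnF; rewrite (henkin_neg HT).
Qed.

(** Systems are closed under generalization, so it is enough to treat
   sentences. *)
Theorem completeness (V : vocabulary) (M : system V) F :
  enumerable M -> renaming_stable M -> formula_of M F ->
  (forall S : structure V, model M S -> forall v : nat -> S, sat v F) ->
  provable M F.
Proof.
move=> Me Mr.
have [n] : exists n, forall x, x \in free F -> x < n.
  by exists (sumn (free F)).+1 => x; rewrite ltnS; exact: fresh_leq.
elim: n F => [|n IH] F leF MF valF.
  apply: completeness_closed => //.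
  by case: (free F) leF => // x s /(_ x (mem_head _ _)).
have : provable M (∀' n, F).
  apply: IH => // [x|S SM v d]; last exact: valF.
  rewrite /= mem_filter => /andP[xn /leF]; rewrite ltnS leq_eqVlt.
  by rewrite (negPf xn).
by move=> P; apply: Pr_mp P _; exact/Pr_logical/Ax_all_elim.
Qed.

(** * Enumerating the formulas of a countable language *)

Fixpoint decode_term (V : vocabulary) (ef : nat -> Defs.fsym V)
    (t : GenTree.tree nat) : term V :=
  match t with
  | GenTree.Leaf x => Var x
  | GenTree.Node n ts => App (ef n) (map (decode_term ef) ts)
  end.

Fixpoint decode (V : vocabulary) (ef : nat -> Defs.fsym V)
    (ep : nat -> psym V) (t : GenTree.tree nat) : formula V :=
  match t with
  | GenTree.Node 0 [:: a; b] => Eq (decode_term ef a) (decode_term ef b)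
  | GenTree.Node 1 (GenTree.Leaf p :: ts) =>
      Rel (ep p) (map (decode_term ef) ts)
  | GenTree.Node 2 [:: a] => Neg (decode ef ep a)
  | GenTree.Node 3 [:: a; b] => Imp (decode ef ep a) (decode ef ep b)
  | GenTree.Node 4 [:: a; b] => And (decode ef ep a) (decode ef ep b)
  | GenTree.Node 5 [:: a; b] => Or (decode ef ep a) (decode ef ep b)
  | GenTree.Node 6 [:: a; b] => Iff (decode ef ep a) (decode ef ep b)
  | GenTree.Node 7 [:: GenTree.Leaf x; a] => All x (decode ef ep a)
  | GenTree.Node 8 [:: GenTree.Leaf x; a] => Ex x (decode ef ep a)
  | _ => Eq (Var 0) (Var 0)
  end.

Lemma enumerable_lang (V : vocabulary) (L : language V)
    (ef : nat -> Defs.fsym V) (ep : nat -> psym V) :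
  (forall f, lfun L f -> exists n, ef n = f) ->
  (forall p, lpred L p -> exists n, ep n = p) -> enumerable L.
Proof.
move=> efP epP.
have codes ts : List.Forall (fun t => exists c, decode_term ef c = t) ts ->
    exists cs, map (decode_term ef) cs = ts.
  elim=> [|t {}ts [c <-] _ [cs <-]]; first by exists [::].
  by exists (c :: cs).
have codet t : term_of L t -> exists c, decode_term ef c = t.
  elim/term_nested_ind: t => [x|f ts IH]; first by exists (GenTree.Leaf x).
  move=> /term_of_AppE[/efP[n <-] _ /(Forall_mp IH)/codes[cs <-]].
  by exists (GenTree.Node n cs).
have codef F : formula_of L F -> exists c, decode ef ep c = F.
  elim: F => [s t|p ts|F IH|F IHF G IHG|F IHF G IHG|F IHF G IHG|F IHF G IHG
       |x F IH|x F IH] /=.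
  - by case=> /codet[c <-] /codet[d <-]; exists (GenTree.Node 0 [:: c; d]).
  - case=> /epP[n <-] _ Lts.
    have [|cs <-] := codes ts; first by apply: List.Forall_impl Lts => t /codet.
    by exists (GenTree.Node 1 (GenTree.Leaf n :: cs)).
  - by move=> /IH[c <-]; exists (GenTree.Node 2 [:: c]).
  - by case=> /IHF[c <-] /IHG[d <-]; exists (GenTree.Node 3 [:: c; d]).
  - by case=> /IHF[c <-] /IHG[d <-]; exists (GenTree.Node 4 [:: c; d]).
  - by case=> /IHF[c <-] /IHG[d <-]; exists (GenTree.Node 5 [:: c; d]).
  - by case=> /IHF[c <-] /IHG[d <-]; exists (GenTree.Node 6 [:: c; d]).
  - by move=> /IH[c <-]; exists (GenTree.Node 7 [:: GenTree.Leaf x; c]).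
  - by move=> /IH[c <-]; exists (GenTree.Node 8 [:: GenTree.Leaf x; c]).
exists (fun n => if unpickle n is Some c then decode ef ep c
                 else Eq (Var 0) (Var 0)).
by move=> F /codef[c <-]; exists (pickle c); rewrite pickleK.
Qed.

Lemma enumerable_RST (O : vocabulary) : enumerable (RST O).
Proof.
apply: (@enumerable_lang (set_vocabulary O) _ (fun=> Sempty) (fun=> Rin)) => //.
move=> p -> /=.
by exists 0.
Qed.

Lemma enumerable_RST_ext (O : vocabulary) : enumerable (RST_ext O).
Proof.
apply: (@enumerable_lang (set_vocabulary O) _
  (nth Sempty [:: Sempty; Sunion; Ssingle; Spower; Spair])
  (nth Rin [:: Rin; Rsub])) => [[||||| f]|[||p]] //= _;
  by [exists 0|exists 1|exists 2|exists 3|exists 4].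
Qed.

(** * The axioms are stable under renaming *)

Lemma vars_rename (V : vocabulary) (f : nat -> nat) (F : formula V) :
  vars (rename f f F) = map f (vars F).
Proof.
elim: F => [s t|p ts|F IH|F IHF G IHG|F IHF G IHG|F IHF G IHG
       |F IHF G IHG|x F IH|x F IH] //=;
  rewrite ?upd_id ?map_cat ?IH ?IHF ?IHG //.
- by rewrite !trename_tvars.
- exact: trenames_tvars.
Qed.

Lemma renaming_stable_RST (O : vocabulary) : renaming_stable (RST O).
Proof.
move=> f fI _ [y u v U|x y u F U RF uF xF|u y z U|x y u U|t u v w x y z U
  |u v w x y U] /=; rewrite !upd_id; move: U; rewrite -(map_inj_uniq fI) => U.
- exact: A1 U.
- apply: A2 U _ _ _; rewrite ?vars_rename ?mem_map //.
  exact: formula_of_rename.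
- exact: A3 U.
- exact: A4 U.
- exact: A5 U.
- exact: A6 U.
Qed.

Lemma renaming_stable_RST_ext (O : vocabulary) : renaming_stable (RST_ext O).
Proof.
move=> f fI _ [F AF|u y U|u v y U|u x y z U|u x y U|u x y z U|z x v w U] /=;
  rewrite ?upd_id; try (move: U; rewrite -(map_inj_uniq fI) => U).
- exact/E0/renaming_stable_RST.
- exact: E1 U.
- exact: E2 U.
- exact: E3 U.
- exact: E4 U.
- exact: E5 U.
- exact: E6 U.
Qed.

(** * Models of RST *)

Definition mem (O : vocabulary) (S : structure (set_vocabulary O)) (a b : S) :
    Prop :=
  @ipred (set_vocabulary O) S Rin [:: a; b].

(** [distinct U] splits the hypothesis [U] that given variables are distinct
   into inequalities, from which [eval_upd] computes the values of variables
   under updated assignments. *)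
Ltac distinct U :=
  move: (U); rewrite /= !inE ?negb_or -?andbA ?andbT;
  repeat match goal with
  | |- is_true (_ && _) -> _ =>
      let D := fresh "D" in let D' := fresh "D" in case/andP=> D D'; move: D'
  end; let D := fresh "D" in move=> D.

Ltac eval_upd := rewrite /= /upd /= ?eqxx;
  repeat match goal with
  | H : is_true (?x != ?y) |- context [?x == ?y] => rewrite !(negPf H)
  | H : is_true (?x != ?y) |- context [?y == ?x] =>
      rewrite !(eq_sym y x) !(negPf H)
  end.

Lemma RST_extensionality (O : vocabulary) (S : structure (set_vocabulary O))
    (a b : S) :
  model (RST O) S -> (forall c, mem c a <-> mem c b) -> a = b.
Proof.
move=> SM; exact: (SM _ (@A1 O 0 1 2 erefl) (upd (upd (fun=> a) 1 a) 2 b)).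
Qed.

(** Parameters of the separation axioms are given by the assignment; the two
   variables for the sets involved are chosen fresh. *)
Lemma RST_separation (O : vocabulary) (S : structure (set_vocabulary O))
    (v : nat -> S) y F a :
  model (RST O) S -> formula_of (RST O) F ->
  exists b, forall c, mem c b <-> mem c a /\ sat (upd v y c) F.
Proof.
move=> SM RF; have [x] := fresh_var (y :: vars F).
have [u] := fresh_var [:: x, y & vars F].
rewrite !inE !negb_or => /and3P[ux uy uF] /andP[xy xF].
have U : uniq [:: x; y; u] by rewrite /= !inE negb_or xy !(eq_sym _ u) ux uy.
have [b Hb] := SM _ (A2 U RF uF xF) (upd v x a); exists b => c.
have E : sat (upd (upd (upd v x a) u b) y c) F = sat (upd v y c) F.
  apply: eq_sat => z /sub_free_vars zF; rewrite /upd; case: eqP => // _.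
  case: eqP zF => [->|_]; first by rewrite (negPf uF).
  by case: eqP => // ->; rewrite (negPf xF).
have : sat (upd (upd (upd v x a) u b) y c) (y ∈' u ↔' (y ∈' x ∧' F)) := Hb c.
by rewrite /= E /mem; eval_upd.
Qed.

Lemma RST_pairing (O : vocabulary) (S : structure (set_vocabulary O))
    (a b : S) :
  model (RST O) S -> exists u, mem a u /\ mem b u.
Proof.
move=> SM; exact: (SM _ (@A4 O 0 1 2 erefl) (upd (fun=> a) 1 b)).
Qed.

Lemma RST_universe (O : vocabulary) (S : structure (set_vocabulary O)) (a : S) :
  model (RST O) S -> exists u : S, [/\ mem a u,
    forall y, mem y u -> forall z, mem z y -> mem z u,
    forall y, mem y u -> exists z, mem z u /\
      forall v, mem v z <-> forall w, mem w v -> mem w y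
  & forall y, mem y u -> forall z, mem z u -> exists v,
      mem v u /\ (mem y v /\ mem z v) /\
      forall w, mem w v -> forall t, mem t w -> mem t v].
Proof.
move=> SM.
have [u [au [utr [upow uu]]]] := SM _ (@A5 O 0 1 2 3 4 5 6 erefl) (fun=> a).
by exists u; split.
Qed.

Lemma RST_empty (O : vocabulary) (S : structure (set_vocabulary O)) (a : S) :
  model (RST O) S -> exists u : S, forall y, ~ mem y u.
Proof.
move=> SM; have RF : formula_of (RST O) (¬' (0 =' 0)) by split; constructor.
have [u Hu] := RST_separation (fun=> a) 0 a SM RF.
by exists u => y /Hu[_ /=].
Qed.

Lemma RST_union (O : vocabulary) (S : structure (set_vocabulary O)) (x : S) :
  model (RST O) S ->
  exists u : S, forall z, mem z u <-> exists y, mem z y /\ mem y x.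
Proof.
move=> SM; have [w [xw wtr _ _]] := RST_universe x SM.
have RF : formula_of (RST O) (∃' 1, (0 ∈' 1 ∧' 1 ∈' 2)).
  by do ![split | constructor].
have [u Hu] := RST_separation (fun=> x) 0 w SM RF; exists u => z.
have {}Hu : mem z u <-> mem z w /\ exists y, mem z y /\ mem y x := Hu z.
rewrite Hu; split=> [[]//|[y [zy yx]]]; split; last by exists y.
exact: wtr (wtr _ xw _ yx) _ zy.
Qed.

Lemma RST_pair (O : vocabulary) (S : structure (set_vocabulary O)) (x y : S) :
  model (RST O) S -> exists u : S, forall z, mem z u <-> z = x \/ z = y.
Proof.
move=> SM; have [w [xw yw]] := RST_pairing x y SM.
have RF : formula_of (RST O) (0 =' 1 ∨' 0 =' 2).
  by do ![split | constructor].
have [u Hu] := RST_separation (upd (fun=> x) 2 y) 0 w SM RF; exists u => z.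
have {}Hu : mem z u <-> mem z w /\ (z = x \/ z = y) := Hu z.
by rewrite Hu; split=> [[]//|[->|->]]; split; auto.
Qed.

Lemma RST_power (O : vocabulary) (S : structure (set_vocabulary O)) (x : S) :
  model (RST O) S ->
  exists z : S, forall v, mem v z <-> forall w, mem w v -> mem w x.
Proof.
move=> SM; have [u [xu _ upow _]] := RST_universe x SM.
by have [z [_ Hz]] := upow _ xu; exists z.
Qed.

(** A universe is inductive: [y ∪ {y}] is separated from a transitive [v] with
   [y ∈ v], hence is an element of the power set of [v], which lies in the
   universe. *)
Lemma RST_inductive (O : vocabulary) (S : structure (set_vocabulary O))
    (a : S) :
  model (RST O) S -> exists x : S,
    (exists y, mem y x /\ forall z, ~ mem z y) /\
    forall y, mem y x ->
      exists z, mem z x /\ forall v, mem v z <-> mem v y \/ v = y.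
Proof.
move=> SM; have [u [au utr upow uu]] := RST_universe a SM; exists u; split.
  have [e He] := RST_empty a SM; exists e; split=> //.
  (* The empty set is an element of the power set of [a]. *)
  have [p [pu Hp]] := upow _ au; apply: utr pu _ _; apply/Hp => w.
  by move/He.
move=> y yu; have [v [vu [[yv _] vtr]]] := uu _ yu _ yu.
have RF : formula_of (RST O) (0 ∈' 1 ∨' 0 =' 1).
  by do ![split | constructor].
have [s Hs] := RST_separation (fun=> y) 0 v SM RF.
have {}Hs c : mem c s <-> mem c v /\ (mem c y \/ c = y) := Hs c.
exists s; split.
  have [p [pu Hp]] := upow _ vu; apply: utr pu _ _; apply/Hp => w.
  by move=> /Hs[].
move=> c; rewrite Hs; split=> [[]//|cy]; split=> //.
by case: cy => [cy|->]; first exact: vtr yv _ cy.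
Qed.

Lemma proves_set_existence_RST (O : vocabulary) : proves_set_existence (RST O).
Proof.
move=> x y z u v w U; distinct U.
split; [split|..].
all: apply: completeness; [exact: enumerable_RST|exact: renaming_stable_RST
  |by do ![split | constructor]|move=> S SM s].
- have [e He] := RST_empty (s x) SM; exists e => c; eval_upd.
  by split=> [/He|[]].
- by have [e He] := RST_empty (s x) SM; exists e => c; eval_upd; exact: He.
- by have [d Hd] := RST_union (s x) SM; exists d => c; eval_upd; exact: Hd.
- by have [d Hd] := RST_pair (s x) (s y) SM; exists d => c; eval_upd; exact: Hd.
- by have [d Hd] := RST_power (s x) SM; exists d => c; eval_upd; exact: Hd.
- have [d Hd] := RST_inductive (s x) SM; exists d; eval_upd; exact: Hd.
Qed.

(** * Expanding models of RST *)

Definition set_of (O : vocabulary) (S : structure (set_vocabulary O)) (d : S)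
    (P : S -> Prop) : S :=
  if pselect (exists a, forall c, mem c a <-> P c) is left ex
  then projT1 (cid ex) else d.

Lemma eq_set_of (O : vocabulary) (S : structure (set_vocabulary O)) (d : S)
    (P : S -> Prop) u :
  model (RST O) S -> (exists a, forall c, mem c a <-> P c) ->
  u = set_of d P <-> forall c, mem c u <-> P c.
Proof.
move=> SM ex; rewrite /set_of; case: pselect => // {}ex; case: cid => a /= Ha.
split=> [->//|Hu]; apply: RST_extensionality => // c.
by rewrite Hu Ha.
Qed.

Definition expansion (O : vocabulary) (S : structure (set_vocabulary O))
    (d : S) : structure (set_vocabulary O) :=
  @Structure (set_vocabulary O) S
  (fun (f : set_fsym (Defs.fsym O)) ds =>
    let x := nth d ds 0 in let y := nth d ds 1 in
    match f with
    | Sempty => set_of d (fun c => False)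
    | Sunion => set_of d (fun c => exists b, mem c b /\ mem b x)
    | Ssingle => set_of d (fun c => c = x)
    | Spair => set_of d (fun c => c = x \/ c = y)
    | Spower => set_of d (fun c => forall b, mem b c -> mem b x)
    | Sother g => d
    end)
  (fun (p : set_psym (psym O)) ds =>
    match p with
    | Rsub => forall c, mem c (nth d ds 0) -> mem c (nth d ds 1)
    | _ => @ipred (set_vocabulary O) S p ds
    end).

(** RST has variables as its only terms and membership as its only predicate, and
   the expansion alters neither. *)
Lemma sat_expansion (O : vocabulary) (S : structure (set_vocabulary O)) (d : S)
    (v : nat -> S) F :
  formula_of (RST O) F -> @sat _ (expansion d) v F <-> sat v F.
Proof.
have ev w t : term_of (RST O) t -> @eval _ (expansion d) w t = @eval _ S w t.
  by case: t => // f ts /term_of_AppE[].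
elim: F v => [s t|p ts|F IH|F IHF G IHG|F IHF G IHG|F IHF G IHG|F IHF G IHG
       |x F IH|x F IH] v /=.
- by case=> Hs Ht; rewrite !ev.
- case=> /= -> _ Hts.
  rewrite (_ : map (@eval _ (expansion d) v) ts = map (@eval _ S v) ts) //.
  by apply: eq_map_Forall; apply: List.Forall_impl Hts => t; exact: ev.
- by move=> /IH->.
1-4: by case=> /IHF-> /IHG->.
- by move=> RF; split=> H c; apply/IH.
- by move=> RF; split=> -[c H]; exists c; apply/IH.
Qed.

Lemma model_expansion (O : vocabulary) (S : structure (set_vocabulary O))
    (d : S) :
  model (RST O) S -> model (RST_ext O) (expansion d).
Proof.
move=> SM _ [F AF|u y U|u v y U|u x y z U|u x y U|u x y z U|z x v w U] s;
  try distinct U.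
- by apply/sat_expansion; [exact: RST_axiom_wf|exact: SM].
- eval_upd; rewrite (eq_set_of _ _ SM); last first.
    by have [e He] := RST_empty d SM; exists e => c; split=> // /He.
  by split=> H c; [case: (H c)|split=> [Hc|[]]; exact: (H c Hc)].
- by eval_upd.
- eval_upd; exact: (eq_set_of _ _ SM (RST_union _ SM)).
- eval_upd; apply: (eq_set_of _ _ SM).
  have [a Ha] := @RST_pair O S (s x) (s x) SM; exists a => c; rewrite Ha; tauto.
- eval_upd; exact: (eq_set_of _ _ SM (RST_pair _ _ SM)).
- eval_upd; exact: (eq_set_of _ _ SM (RST_power _ SM)).
Qed.

Lemma model_RST_ext (O : vocabulary) (S : structure (set_vocabulary O)) :
  model (RST_ext O) S -> model (RST O) S.
Proof. by move=> SM F AF; apply: SM; exact: E0. Qed.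

(** Holds because every model of RST_ext is a model of RST. *)
Lemma extension_RST_ext (O : vocabulary) : extension (RST O) (RST_ext O).
Proof.
have Lp p : lpred (RST O) p -> lpred (RST_ext O) p by move=> /= ->.
split=> // [t|F PF]; first exact: term_of_mono.
apply: completeness; [exact: enumerable_RST_ext|exact: renaming_stable_RST_ext
  |by apply: formula_of_mono (provable_wf PF)|].
by move=> S SM v; exact: (soundness (model_RST_ext SM) PF).
Qed.

Lemma conservative_RST_ext (O : vocabulary) :
  conservative_extension (RST O) (RST_ext O).
Proof.
split; first exact: extension_RST_ext.
move=> F RF PF; apply: (completeness _ _ RF);
  [exact: enumerable_RST|exact: renaming_stable_RST|move=> S SM v].
exact: (@sat_expansion O S (v 0) v F RF).1
         (soundness (@model_expansion O S (v 0) SM) PF v).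
Qed.

(** * Eliminating the defined symbols *)

(** One RST-formula has to work for all assignments, but it may depend on the
   model. *)
Definition definable (O : vocabulary) (S : structure (set_vocabulary O))
    (P : (nat -> S) -> Prop) : Prop :=
  exists2 G, formula_of (RST O) G & forall v, sat v G <-> P v.

Lemma eq_definable (O : vocabulary) (S : structure (set_vocabulary O))
    (P Q : (nat -> S) -> Prop) :
  (forall v, P v <-> Q v) -> definable P -> definable Q.
Proof. by move=> PQ [G RG GP]; exists G => // v; rewrite GP. Qed.

(** [Q] holds of the value of [t] if and only if it holds of some [z] equal to
   that value. *)
Lemma definable_at_term (O : vocabulary) (S : structure (set_vocabulary O))
    z t (Q : (nat -> S) -> Prop) :
  z \notin tvars t -> definable (fun v : nat -> S => v z = eval v t) ->
  definable Q -> definable (fun v => Q (upd v z (eval v t))).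
Proof.
move=> zt [G RG GP] [H RH HP]; exists (∃' z, (G ∧' H)) => // v.
have E d : eval (upd v z d) t = eval v t.
  by apply: eq_eval => y yt; apply: upd_neq; apply: contraNneq zt => <-.
split=> /= [[d [/GP Gd /HP]]|Qv].
  by move: Gd; rewrite upd_eq E => ->.
by exists (eval v t); split; [apply/GP; rewrite upd_eq E|apply/HP].
Qed.

(** Three arguments suffice for all symbols of RST_ext, as the equation between
   a variable and a value of [σ_2] relates three elements; relations of fewer
   arguments ignore the others. *)
Lemma definable_at_terms (O : vocabulary) (S : structure (set_vocabulary O))
    (R : S -> S -> S -> Prop) t1 t2 t3 :
  (forall a b c, uniq [:: a; b; c] ->
    definable (fun v : nat -> S => R (v a) (v b) (v c))) ->
  (forall z, definable (fun v : nat -> S => v z = eval v t1)) ->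
  (forall z, definable (fun v : nat -> S => v z = eval v t2)) ->
  (forall z, definable (fun v : nat -> S => v z = eval v t3)) ->
  definable (fun v : nat -> S => R (eval v t1) (eval v t2) (eval v t3)).
Proof.
move=> DR D1 D2 D3.
have [a] := fresh_var (tvars t1 ++ tvars t2 ++ tvars t3).
have [b] := fresh_var (a :: tvars t1 ++ tvars t2 ++ tvars t3).
have [c] := fresh_var [:: a, b & tvars t1 ++ tvars t2 ++ tvars t3].
rewrite !inE !mem_cat !negb_or.
move=> /and5P[ca cb c1 c2 c3] /and4P[ba b1 b2 b3] /and3P[a1 a2 a3].
have E (v : nat -> S) z d t : z \notin tvars t -> eval (upd v z d) t = eval v t.
  move=> zt; apply: eq_eval => y yt; apply: upd_neq.
  by apply: contraNneq zt => <-.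
have U : uniq [:: c; b; a] by rewrite /= !inE negb_or cb ca ba.
have := DR _ _ _ U.
move=> /(definable_at_term a3 (D3 a)) /(definable_at_term b2 (D2 b)).
move=> /(definable_at_term c1 (D1 c)); apply: eq_definable => v.
rewrite !(E _ _ _ _ c2, E _ _ _ _ c3, E _ _ _ _ b3) /upd !eqxx.
by rewrite (negPf cb) (negPf ca) (negPf ba).
Qed.

Lemma definable_var (O : vocabulary) (S : structure (set_vocabulary O)) x y :
  definable (fun v : nat -> S => v x = eval v (Var y)).
Proof. by exists (x =' y) => //; split; constructor. Qed.

(** The defining axioms equate an atomic formula with an RST-formula. *)
Lemma definable_iff (O : vocabulary) (S : structure (set_vocabulary O)) F G :
  model (RST_ext O) S -> RST_ext_axiom (F ↔' G) -> formula_of (RST O) G ->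
  definable (fun v : nat -> S => sat v F).
Proof. by move=> SM AFG RG; exists G => // v; have [] := SM _ AFG v. Qed.

(** By induction on the term, with the defining axiom of its head symbol. *)
Lemma definable_term (O : vocabulary) (S : structure (set_vocabulary O)) t :
  model (RST_ext O) S -> term_of (RST_ext O) t ->
  forall z, definable (fun v : nat -> S => v z = eval v t).
Proof.
move=> SM; elim/term_nested_ind: t => [x|f ts IH] Ht z.
  exact: definable_var.
have [Lf sz Hts] := term_of_AppE Ht; have {IH Hts Ht} := Forall_mp IH Hts.
have DV x y := @definable_var O S x y.
have app1 (f' : set_fsym (Defs.fsym O)) t1 :
    (forall a b c d, uniq [:: a; b; c; d] ->
      definable (fun v : nat -> S => sat v (eq_app a f' [:: b]))) ->
    (forall y, definable (fun v : nat -> S => v y = eval v t1)) ->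
    definable (fun v : nat -> S =>
      v z = @ifun (set_vocabulary O) S f' [:: eval v t1]).
  move=> Df Dt; apply: (@definable_at_terms O S
    (fun d e _ => d = @ifun (set_vocabulary O) S f' [:: e])
    (Var z) t1 (Var z)) => // a b c U.
  (* The defining axioms bind up to two further variables. *)
  have [d dabc] := fresh_var [:: a; b; c]; apply: (Df a b c d).
  by rewrite -(rot_uniq 3) cons_uniq dabc.
case: f Lf sz => [||||| f] // _.
- case: ts => // _ _.
  apply: (@definable_at_terms O S
    (fun d _ _ => d = @ifun (set_vocabulary O) S Sempty [::])
    (Var z) (Var z) (Var z)) => // a b c U; distinct U.
  apply: (definable_iff SM (@E1 O a b _)) => //=; do ?by do ![split | constructor].
  by rewrite inE D.
- case: ts => [|t1 []] // _ /List.Forall_cons_iff[Dt _].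
  apply: app1 Dt => a b c d U.
  by apply: (definable_iff SM (@E3 O a b c d U)); do ![split | constructor].
- case: ts => [|t1 []] // _ /List.Forall_cons_iff[Dt _].
  apply: app1 Dt => a b c d; rewrite (cat_uniq [:: a; b; c]) => /andP[U _].
  by apply: (definable_iff SM (@E4 O a b c U)); do ![split | constructor].
- case: ts => [|t1 []] // _ /List.Forall_cons_iff[Dt _].
  apply: app1 Dt => a b c d U.
  by apply: (definable_iff SM (@E6 O a b c d U)); do ![split | constructor].
case: ts => [|t1 [|t2 []]] // _.
move=> /List.Forall_cons_iff[Dt1 /List.Forall_cons_iff[Dt2 _]].
apply: (@definable_at_terms O S
  (fun d x y => d = @ifun (set_vocabulary O) S Spair [:: x; y])
  (Var z) t1 t2) => // a b c U.
have [d dabc] := fresh_var [:: a; b; c].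
have U' : uniq [:: a; b; c; d] by rewrite -(rot_uniq 3) cons_uniq dabc.
by apply: (definable_iff SM (@E5 O a b c d U')); do ![split | constructor].
Qed.

(** Atomic formulas are unnested with [definable_at_terms]; connectives and
   quantifiers are translated by themselves. *)
Lemma definable_formula (O : vocabulary) (S : structure (set_vocabulary O)) F :
  model (RST_ext O) S -> formula_of (RST_ext O) F ->
  definable (fun v : nat -> S => sat v F).
Proof.
move=> SM; have DV x y := @definable_var O S x y.
have Dt t := @definable_term O S t SM.
elim: F => [s t|p ts|F IH|F IHF G IHG|F IHF G IHG|F IHF G IHG|F IHF G IHG
       |x F IH|x F IH] /=.
- case=> /Dt Ds /Dt{}Dt.
  apply: (@definable_at_terms O S (fun d e _ => d = e) s t (Var 0)) => //.
  by move=> a b c _; exact: DV.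
- case: p => [||p] [] //= _.
    case: ts => [|t1 [|t2 []]] // _.
    move=> /List.Forall_cons_iff[D1 /List.Forall_cons_iff[D2 _]].
    apply: (@definable_at_terms O S (fun d e _ => mem d e) t1 t2 (Var 0));
      try by [exact: Dt|].
    by move=> a b c _; exists (a ∈' b); first by do ![split | constructor].
  case: ts => [|t1 [|t2 []]] // _.
  move=> /List.Forall_cons_iff[D1 /List.Forall_cons_iff[D2 _]].
  apply: (@definable_at_terms O S
    (fun d e _ => @ipred (set_vocabulary O) S Rsub [:: d; e]) t1 t2 (Var 0));
    try by [exact: Dt|].
  move=> a b c U.
  by apply: (definable_iff SM (@E2 O a b c U)); do ![split | constructor].
- by case/IH=> G RG GP; exists (¬' G) => // v /=; rewrite GP.
1-4: case=> /IHF[F' RF FP] /IHG[G' RG GP].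
- by exists (F' →' G') => // v /=; rewrite FP GP.
- by exists (F' ∧' G') => // v /=; rewrite FP GP.
- by exists (F' ∨' G') => // v /=; rewrite FP GP.
- by exists (F' ↔' G') => // v /=; rewrite FP GP.
- by case/IH=> G RG GP; exists (∀' x, G) => // v /=; split=> H d; apply/GP.
- by case/IH=> G RG GP; exists (∃' x, G) => // v /=;
    split=> -[d H]; exists d; apply/GP.
Qed.

Lemma sf_theory_RST_ext (O : vocabulary) : sf_theory (RST_ext O).
Proof.
split; first exact: extension_RST_ext.
move=> x y u F U MF uF xF; apply: completeness;
  [exact: enumerable_RST_ext|exact: renaming_stable_RST_ext
  |by do ?[split | constructor]|move=> S SM v].
have [G RG GP] := definable_formula SM MF.
have [b Hb] := RST_separation v y (v x) (model_RST_ext SM) RG.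
exists b => c; have {Hb} := Hb c; rewrite GP.
have E : sat (upd (upd v u b) y c) F = sat (upd v y c) F.
  apply: eq_sat => z /sub_free_vars zF; rewrite /upd; case: eqP => // _.
  by case: eqP zF => // ->; rewrite (negPf uF).
distinct U; move=> Hb.
change (sat (upd (upd v u b) y c) (y ∈' u ↔' (y ∈' x ∧' F))).
by rewrite /= E; move: Hb; rewrite /mem; eval_upd.
Qed.

Theorem theorem4p10 (O : vocabulary) :
  [/\ sf_theory (RST_ext O),
      conservative_extension (RST O) (RST_ext O),
      proves_set_existence (RST O)
    & forall M : system (set_vocabulary O),
        sf_theory M -> proves_set_existence M].
Proof.
split; [exact: sf_theory_RST_ext|exact: conservative_RST_ext
  |exact: proves_set_existence_RST|move=> M [[_ _ _ RM] _] x y z u v w U].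
by have [[]] := proves_set_existence_RST O U; split; [split|..]; apply: RM.
Qed.
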